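(* For every integer $k\ge 3$ there exists $n_0$ such that the following holds for all $n\ge n_0$. Let $H$ be a $k$-partite $k$-graph with parts $V_1,\dots,V_k$, each of size $n$. Then $H$ contains a matching of size $n-1$ if one of the following holds: (1) $n\equiv 1 \pmod k$ and $\delta'_{k-1}(H)\ge\lfloor n/k\rfloor$; (2) $\delta'_{k-1}(H)\ge\lceil n/k\rceil$.
   Context: A $k$-graph ($k$-uniform hypergraph) consists of a vertex set $V(H)$ and an edge set $E(H)$ of $k$-element subsets of $V(H)$. It is $k$-partite with parts $V_1,\dots,V_k$ if these sets partition $V(H)$ and every edge contains exactly one vertex from each $V_i$. A matching is a collection of pairwise disjoint edges; its size is the number of edges. A set $S\subseteq V(H)$ is crossing if $|S\cap V_i|\le 1$ for all $i$. For a $(k-1)$-set $S$, $\deg_H(S)$ is the number of vertices $v\in V(H)\setminus S$ with $S\cup\{v\}\in E(H)$. The partite minimum codegree $\delta'_{k-1}(H)$ is the minimum of $\deg_H(S)$ over all crossing $(k-1)$-sets $S$ of $V(H)$. *)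

(* Defs.v *)
From mathcomp Require Import all_boot.

Set Implicit Arguments.
Unset Strict Implicit.
Unset Printing Implicit Defensive.

(* A hypergraph on the finite vertex type V is given by its edge set
   E : {set {set V}}; a k-partition of its vertices by the indexed family
   P : 'I_k -> {set V}. *)

Definition uniform (V : finType) (k : nat) (E : {set {set V}}) : Prop :=
  forall e : {set V}, e \in E -> #|e| = k.

Definition vertex_partition (V : finType) (k : nat) (P : 'I_k -> {set V})
  : Prop :=
  (forall i j : 'I_k, i != j -> [disjoint P i & P j]) /\
  \bigcup_(i < k) P i = [set: V].

Definition kpartite (V : finType) (k : nat) (P : 'I_k -> {set V})
    (E : {set {set V}}) : Prop :=
  vertex_partition P /\
  (forall (e : {set V}) (i : 'I_k), e \in E -> #|e :&: P i| = 1).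

Definition matching (V : finType) (E M : {set {set V}}) : Prop :=
  M \subset E /\
  (forall e f : {set V}, e \in M -> f \in M -> e != f -> [disjoint e & f]).

Definition crossing (V : finType) (k : nat) (P : 'I_k -> {set V})
    (S : {set V}) : bool :=
  [forall i : 'I_k, #|S :&: P i| <= 1].

Definition deg (V : finType) (E : {set {set V}}) (S : {set V}) : nat :=
  #|[set v : V | (v \notin S) && (v |: S \in E)]|.

(* Since deg E S <= #|V|, the neutral value #|V| does not affect the minimum
   as soon as there is a crossing (k-1)-set, e.g. when all parts are
   nonempty. *)
Definition partite_min_codeg (V : finType) (k : nat) (P : 'I_k -> {set V})
    (E : {set {set V}}) : nat :=
  \big[minn/#|V|]_(S : {set V} | (#|S| == k - 1) && crossing P S) deg E S.

Definition ceil_div (m d : nat) : nat := (m + (d - 1)) %/ d.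

Lemma ceil_div_leq (m d q : nat) :
  0 < d -> (ceil_div m d <= q) = (m <= q * d).
Proof.
case: d => // d _; rewrite /ceil_div subn1 /= -ltnS ltn_divLR //.
by rewrite mulSn addnC addSn ltnS leq_add2l.
Qed.

(* Main.v *)
Require Import Defs.
From mathcomp Require Import all_boot zify.

Set Implicit Arguments.
Unset Strict Implicit.
Unset Printing Implicit Defensive.

(** A hypergraph with parts of size [n] is encoded by vectors [f], one vertex
    [f i] in each part, and the codegree condition becomes: changing any one
    coordinate of any vector gives at least [d] edges.  Both hypotheses of the
    theorem say [n <= k * d + 1], and a matching with [n - 1] edges is wanted.

    If a matching [M] leaves at least [k] vertices uncovered in each part,
    take disjoint uncovered vectors [s_1, ..., s_k] and look at the vertices
    which complete [s_i] to an edge when put at coordinate [i].  There are at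
    least [k * d] of them altogether.  If one is uncovered, [M] grows at once;
    otherwise, as long as [M] has fewer than [k * d] edges, one of its edges
    contains two, and trading that edge for the two new ones enlarges [M].
    This leaves a bounded number of edges, and the proof consists in gaining
    these.

    The gain comes from absorbers: edges [e] which, together with two
    uncovered vectors, contain two disjoint edges.  Every pair of uncovered
    vectors has a positive proportion of all vectors as absorbers, so greedily
    a matching [Q] of size [O(log n)] is found which contains [k^2] absorbers
    for each pair; any matching that contains [Q] and leaves [k^2] vertices of
    each part uncovered can then be enlarged until at most one vertex of each
    part is left ([absorbing_exists]).

    Now let [M] be a maximum matching in the complement of [Q].  Setting [Q]
    aside has lowered the codegrees by [O(log n)], so the counting above no
    longer gives a contradiction, but it leaves no slack beyond [O(log n)]:
    almost all edges of [M] are hit exactly once.  The vertices of these edges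
    that are not hit form sets [B_i] with no edge of the hypergraph inside,
    since such an edge would allow a bigger exchange; and the complement of
    [B_i] has only [d + O(log n)] vertices ([large_matching_or_sparse]).

    In this sparse case an edge with [k - 1] vertices in the sets [B_j] has its
    last vertex outside; as there are at least [d] choices for it among
    [d + O(log n)] vertices, almost all vectors of the shape (one vertex
    outside, the others inside) are edges.  At least [d] vertices outside [B_i], the heavy ones, are
    in many such edges.  The exceptional vertices, [O(log n)] in number, are
    covered one by one; then edges with two or three heavy vertices are used
    until the number of heavy vertices left equals the number of edges still
    to be chosen, or is one less ([balance_weight]).  What remains splits into
    nearly complete blocks, one for each part [i], in which the heavy vertices
    of that part are matched by an exchange argument ([block_matching]).  All
    error terms are quadratic in [log n] at worst, hence below [n] for large
    [n]. *)

(** * Vectors, matchings and double counting *)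

Lemma card_bigcup_le (I U : finType) (F : I -> {set U}) :
  #|\bigcup_i F i| <= \sum_i #|F i|.
Proof.
elim/big_ind2: _ => [|A x B y Ax By|//]; first by rewrite cards0.
by apply: leq_trans (leq_card_setU _ _) _; apply: leq_add.
Qed.

Section Vectors.
Variables (k : nat) (T : finType).
Local Notation vec := {ffun 'I_k -> T}.
Implicit Types (f g e : vec) (H M N D P Q : {set vec}) (X : 'I_k -> {set T}).

(** Membership of [upd f i x] in a set does not depend on [f i]; in this way a
    whole vector also stands for the vector without its [i]-th coordinate. *)
Definition upd f (i : 'I_k) (x : T) : vec :=
  [ffun j => if j == i then x else f j].

Definition cov M (i : 'I_k) : {set T} := [set (f : vec) i | f in M].

Definition vmatching H M : bool :=
  (M \subset H) && [forall i, dinjectiveb (fun f : vec => f i) (mem M)].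

Definition inbox X M : bool := [forall f in M, forall i, (f : vec) i \in X i].

Definition codeg_ge H (d : nat) : Prop :=
  forall f i, d <= #|[set x | upd f i x \in H]|.

Lemma updE f i x j : upd f i x j = if j == i then x else f j.
Proof. by rewrite ffunE. Qed.

Lemma upd_at f i x : upd f i x i = x.
Proof. by rewrite updE eqxx. Qed.

Lemma upd_ne f i x j : j != i -> upd f i x j = f j.
Proof. by rewrite updE => /negPf->. Qed.

Lemma upd_id f i : upd f i (f i) = f.
Proof. by apply/ffunP => j; rewrite updE; case: eqP => [->|]. Qed.

Lemma upd_upd f i x y : upd (upd f i x) i y = upd f i y.
Proof. by apply/ffunP => j; rewrite !updE; case: eqP. Qed.

Lemma updC f i j x y : i != j -> upd (upd f i x) j y = upd (upd f j y) i x.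
Proof.
move=> ij; apply/ffunP => l; rewrite !updE.
by case: (eqVneq l j) => [->|//]; rewrite eq_sym (negPf ij).
Qed.

Lemma vmatchingP H M :
  reflect (M \subset H /\ forall i, {in M &, injective (fun f : vec => f i)})
          (vmatching H M).
Proof.
apply: (iffP andP) => [[sMH /forallP inj]|[sMH inj]]; split => //.
  by move=> i; apply/dinjectiveP/inj.
by apply/forallP => i; apply/dinjectiveP/inj.
Qed.

Lemma inboxP X M :
  reflect (forall f i, f \in M -> f i \in X i) (inbox X M).
Proof.
apply: (iffP forall_inP) => [h f i /h/forallP //|h f fM].
by apply/forallP => i; apply: h.
Qed.

Lemma vmatching_sub H M : vmatching H M -> M \subset H.
Proof. by case/vmatchingP. Qed.

Lemma vmatching_inj H M f g i :
  vmatching H M -> f \in M -> g \in M -> f i = g i -> f = g.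
Proof. by case/vmatchingP => _ inj fM gM; apply: inj. Qed.

Lemma vmatching0 H : vmatching H set0.
Proof. by apply/vmatchingP; split=> [|i f]; rewrite ?sub0set // inE. Qed.

Lemma vmatching1 H e : e \in H -> vmatching H [set e].
Proof.
move=> eH; apply/vmatchingP; split=> [|i f g]; first by rewrite sub1set.
by rewrite !inE => /eqP-> /eqP->.
Qed.

Lemma sub_vmatching H M N : N \subset M -> vmatching H M -> vmatching H N.
Proof.
move=> sNM /vmatchingP[sMH inj]; apply/vmatchingP; split.
  exact: subset_trans sNM sMH.
by move=> i f g fN gN; apply: inj; apply: (subsetP sNM).
Qed.

Lemma covP M i x : reflect (exists2 f, f \in M & x = f i) (x \in cov M i).
Proof. exact: imsetP. Qed.

Lemma mem_cov M i f : f \in M -> f i \in cov M i.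
Proof. exact: (imset_f (fun f : vec => f i)). Qed.

Lemma card_cov H M i : vmatching H M -> #|cov M i| = #|M|.
Proof. by case/vmatchingP => _ inj; rewrite card_in_imset //; apply: inj. Qed.

Lemma cov_sub M N i : M \subset N -> cov M i \subset cov N i.
Proof. exact: imsetS. Qed.

Lemma covU M N i : cov (M :|: N) i = cov M i :|: cov N i.
Proof. exact: imsetU. Qed.

Lemma cov0 i : cov set0 i = set0.
Proof. exact: imset0. Qed.

Lemma cov_set1 e i : cov [set e] i = [set e i].
Proof. exact: imset_set1. Qed.

Lemma notin_covD H M D f j :
  vmatching H M -> D \subset M -> f \in D -> f j \notin cov (M :\: D) j.
Proof.
move=> mM sDM fD; apply/covP => -[g]; rewrite inE => /andP[gD gM] eq_fg.
by case/negP: gD; rewrite -(vmatching_inj mM (subsetP sDM f fD) gM eq_fg).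
Qed.

Lemma vmatchingU H M N :
  vmatching H M -> vmatching H N ->
  (forall e j, e \in N -> e j \notin cov M j) ->
  vmatching H (M :|: N).
Proof.
move=> mM mN dNM; apply/vmatchingP; split.
  by rewrite subUset !vmatching_sub.
move=> i f g; rewrite !inE => /orP[fM|fN] /orP[gM|gN] eq_fg.
- exact: vmatching_inj mM fM gM eq_fg.
- by case/negP: (dNM _ i gN); rewrite -eq_fg mem_cov.
- by case/negP: (dNM _ i fN); rewrite eq_fg mem_cov.
exact: vmatching_inj mN fN gN eq_fg.
Qed.

Lemma cardU_uncovered M N :
  0 < k -> (forall e j, e \in N -> e j \notin cov M j) ->
  #|M :|: N| = #|M| + #|N|.
Proof.
move=> k0 dNM; rewrite cardsU disjoint_setI0 ?cards0 ?subn0 //.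
rewrite disjoint_sym disjoint_subset; apply/subsetP => e eN; rewrite inE.
by apply: contra (dNM e (Ordinal k0) eN); apply: mem_cov.
Qed.

(** Absorption and all arguments from maximality are instances of this
    exchange. *)
Lemma vmatching_swap H M D N :
  0 < k -> vmatching H M -> D \subset M -> vmatching H N ->
  (forall e j, e \in N -> e j \notin cov (M :\: D) j) ->
  vmatching H ((M :\: D) :|: N) /\ #|(M :\: D) :|: N| + #|D| = #|M| + #|N|.
Proof.
move=> k0 mM sDM mN dN; split.
  by apply: vmatchingU => //; apply: sub_vmatching mM; apply: subsetDl.
rewrite cardU_uncovered // addnAC; congr (_ + _).
by rewrite cardsD (setIidPr sDM) subnK // subset_leq_card.
Qed.

Lemma exists_max_vmatching H X :
  exists M, [/\ vmatching H M, inbox X M &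
    forall N, vmatching H N -> inbox X N -> #|N| <= #|M|].
Proof.
pose p M := vmatching H M && inbox X M.
have p0 : p set0 by rewrite /p vmatching0; apply/inboxP => f i; rewrite inE.
case: (@arg_maxnP _ set0 p (fun M => #|M|) p0) => M /andP[mM bM] maxM.
by exists M; split=> // N mN bN; apply: maxM; rewrite /p mN.
Qed.

Lemma max_no_gain H X M D N :
  0 < k -> vmatching H M -> inbox X M ->
  (forall N, vmatching H N -> inbox X N -> #|N| <= #|M|) ->
  D \subset M -> vmatching H N -> inbox X N ->
  (forall e j, e \in N -> e j \notin cov (M :\: D) j) ->
  #|N| <= #|D|.
Proof.
move=> k0 mM bM maxM sDM mN bN dN.
have [mR cR] := vmatching_swap k0 mM sDM mN dN.
have bR : inbox X ((M :\: D) :|: N).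
  apply/inboxP => f i; rewrite !inE => /orP[/andP[_ fM]|fN].
    exact: (inboxP _ _ bM).
  exact: (inboxP _ _ bN).
by have := maxM _ mR bR; lia.
Qed.

(** Both sides count the pairs [(f, x)] with [f \in P] and
    [upd f i x \in Q], because exchanging [x] and [f i] is an involution. *)
Lemma fiber_sum P Q i :
  (forall f x, f \in P -> upd f i x \in P) ->
  \sum_(f in P) #|[set x | upd f i x \in Q]| = #|T| * #|P :&: Q|.
Proof.
move=> Pupd.
pose S := [set p : vec * T | (p.1 \in P) && (upd p.1 i p.2 \in Q)].
pose h (p : vec * T) := (upd p.1 i p.2, p.1 i).
have hK : involutive h by move=> [f x]; rewrite /h /= upd_upd upd_id upd_at.
have -> : #|T| * #|P :&: Q| = #|setX (P :&: Q) [set: T]|.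
  by rewrite cardsX cardsT mulnC.
have -> : setX (P :&: Q) [set: T] = h @: S.
  apply/setP => p; rewrite -{2}(hK p) (mem_imset _ _ (inv_inj hK)).
  rewrite !inE /= upd_upd upd_id andbT; congr (_ && _).
  by apply/idP/idP => [/Pupd//|/(Pupd _ (p.1 i))]; rewrite upd_upd upd_id.
rewrite (card_imset _ (inv_inj hK)) -sum1_card.
under eq_bigr => f _ do rewrite -sum1_card.
rewrite pair_big_dep /=; apply: eq_bigl => -[f x] /=.
by rewrite !inE.
Qed.

Lemma fiber_ge P Q i d :
  (forall f x, f \in P -> upd f i x \in P) ->
  (forall f, f \in P -> d <= #|[set x | upd f i x \in Q]|) ->
  d * #|P| <= #|T| * #|P :&: Q|.
Proof.
move=> Pupd dP; rewrite -(fiber_sum _ Pupd) mulnC -sum_nat_const.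
exact: leq_sum.
Qed.

Lemma fiber_le Q i d :
  (forall f, #|[set x | upd f i x \in Q]| <= d) -> #|T| * #|Q| <= d * #|T| ^ k.
Proof.
move=> dQ; have <- : #|{: vec}| = #|T| ^ k by rewrite card_ffun card_ord.
rewrite -[Q]setTI -(@fiber_sum setT Q i) => [|f x _]; last by rewrite inE.
rewrite mulnC -cardsT -sum_nat_const; exact: leq_sum.
Qed.

Lemma card_at_in i (U : {set T}) :
  #|T| * #|[set f : vec | f i \in U]| <= #|U| * #|T| ^ k.
Proof.
apply: (@fiber_le _ i) => f; apply: subset_leq_card.
by apply/subsetP => x; rewrite !inE upd_at.
Qed.

(** A small matching therefore spoils only a small proportion of a dense set of
    candidates. *)
Lemma card_hitting (U : 'I_k -> {set T}) m :
  (forall i, #|U i| <= m) ->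
  #|T| * #|[set f : vec | [exists i, f i \in U i]]| <= k * m * #|T| ^ k.
Proof.
move=> Um.
have sub : [set f : vec | [exists i, f i \in U i]] \subset
    \bigcup_i [set f : vec | f i \in U i].
  apply/subsetP => f; rewrite inE => /existsP[i fi].
  by apply/bigcupP; exists i; rewrite ?inE.
apply: (@leq_trans (\sum_(i < k) #|T| * #|[set f : vec | f i \in U i]|)).
  rewrite -big_distrr /= leq_mul2l; apply/orP; right.
  exact: leq_trans (subset_leq_card sub) (card_bigcup_le _).
apply: (@leq_trans (\sum_(i < k) m * #|T| ^ k)).
  apply: leq_sum => i _; apply: leq_trans (card_at_in i (U i)) _.
  by rewrite leq_mul2r Um orbT.
by rewrite sum_nat_const card_ord mulnA.
Qed.

Lemma disjoint_vectors (J : finType) X :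
  (forall i, #|J| <= #|X i|) ->
  exists s : J -> vec, (forall a i, s a i \in X i) /\
    (forall a b i, s a i = s b i -> a = b).
Proof.
move=> JX.
exists (fun a => [ffun i => enum_val (widen_ord (JX i) (enum_rank a))]); split.
  by move=> a i; rewrite ffunE enum_valP.
move=> a b i; rewrite !ffunE => /enum_val_inj /(congr1 val) /= /val_inj.
exact: enum_rank_inj.
Qed.

End Vectors.

(** * Covering all configurations by a small matching *)

Section Covering.
Variables (k : nat) (T : finType) (H : {set {ffun 'I_k -> T}}).
Variables (Cfg : finType) (Abs : Cfg -> {set {ffun 'I_k -> T}}) (c : nat).
Hypotheses (k_gt0 : 0 < k) (T_gt0 : 0 < #|T|).
Hypothesis AbsH : forall s, Abs s \subset H.
Hypothesis AbsC : forall s, #|T| ^ k <= c * #|Abs s|.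
Local Notation vec := {ffun 'I_k -> T}.

(** Averaging: the edges that meet [M] are at most half of the set [Abs s] for
    each configuration [s], so among the others some edge serves an average
    share of the configurations in [C]. *)
Lemma popular_edge (M : {set vec}) (C : {set Cfg}) :
  vmatching H M -> 2 * c * (k * #|M|) <= #|T| -> 0 < #|C| ->
  exists e, [/\ e \in H, forall i, e i \notin cov M i &
    #|C| <= 2 * c * #|[set s in C | e \in Abs s]|].
Proof.
move=> mM bM C0.
pose Hit := [set e : vec | [exists i, e i \in cov M i]].
have hit : 2 * c * #|Hit| <= #|T| ^ k.
  have cM i : #|cov M i| <= #|M| by rewrite (card_cov i mM).
  have := card_hitting cM; rewrite -/Hit => h.
  rewrite -(leq_pmul2l T_gt0) mulnCA.
  apply: leq_trans (leq_mul (leqnn (2 * c)) h) _.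
  by rewrite mulnA leq_mul.
have many s : #|T| ^ k <= 2 * c * #|Abs s :\: Hit|.
  have := AbsC s; have := cardsD (Abs s) Hit.
  have := subset_leq_card (subsetIr (Abs s) Hit).
  have : 2 * c * #|Abs s :&: Hit| <= 2 * c * #|Hit|.
    by rewrite leq_mul2l subset_leq_card ?orbT // subsetIr.
  have := cardsID Hit (Abs s).
  nia.
have [e /andP[eF ce]|none] := pickP [pred e | (e \notin Hit) &&
    (#|C| <= 2 * c * #|[set s in C | e \in Abs s]|)].
  exists e; split=> //; last first.
    by move=> i; apply: contra eF => ei; rewrite inE; apply/existsP; exists i.
  have : 0 < #|[set s in C | e \in Abs s]|.
    by move: ce; set m := #|_|; nia.
  by case/card_gt0P => s; rewrite inE => /andP[_]; apply: (subsetP (AbsH s)).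
have dc : \sum_(e | e \notin Hit) #|[set s in C | e \in Abs s]| =
    \sum_(s in C) #|Abs s :\: Hit|.
  under eq_bigr => e _ do rewrite -sum1_card.
  rewrite (exchange_big_dep (mem C)) /= => [|e s _]; last first.
    by rewrite inE => /andP[].
  apply: eq_bigr => s sC; rewrite -sum1_card; apply: eq_bigl => e.
  by rewrite !inE sC.
have lo : #|T| ^ k * #|C| <= 2 * c * \sum_(s in C) #|Abs s :\: Hit|.
  by rewrite big_distrr /= mulnC -sum_nat_const leq_sum.
have up : 2 * c * \sum_(e | e \notin Hit) #|[set s in C | e \in Abs s]|
    <= #|T| ^ k * #|C|.-1.
  rewrite big_distrr /= (@leq_trans (\sum_(e | e \notin Hit) #|C|.-1)) //.
    apply: leq_sum => e eF; have := none e; rewrite /= eF /= => /negbT.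
    by rewrite -ltnNge; lia.
  rewrite sum_nat_const leq_mul2r; apply/orP; right.
  by apply: leq_trans (max_card _) _; rewrite card_ffun card_ord.
have : 0 < #|T| ^ k by rewrite expn_gt0 T_gt0.
rewrite dc in up; move=> n0; have := leq_trans lo up.
by rewrite leq_mul2l; lia.
Qed.

Definition uncovered (M0 M : {set vec}) : {set Cfg} :=
  [set s | [forall e in M :\: M0, e \notin Abs s]].

(** Each new popular edge leaves at most the fraction [1 - 1 / (2 * c)] of the
    configurations that were not served before. *)
Lemma cover_iter (M0 : {set vec}) (t : nat) :
  vmatching H M0 -> 2 * c * (k * (#|M0| + t)) <= #|T| ->
  exists M, [/\ vmatching H M, M0 \subset M, #|M| <= #|M0| + t &
    (2 * c) ^ t * #|uncovered M0 M| <= (2 * c).-1 ^ t * #|Cfg|].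
Proof.
move=> mM0; elim: t => [|t IH] bt.
  exists M0; split=> //; first by rewrite addn0.
  by rewrite !expn0 !mul1n max_card.
have [|M [mM sM cM uM]] := IH; first by nia.
have [U0|U0] := posnP #|uncovered M0 M|.
  by exists M; split; rewrite ?U0 ?muln0 //; lia.
have [|e [eH eM pe]] := popular_edge mM _ U0; first by nia.
have eNM : e \notin M.
  by apply: contra (eM (Ordinal k_gt0)); apply: mem_cov.
exists (M :|: [set e]); split.
- by apply: vmatchingU; rewrite ?vmatching1 // => f j /set1P->.
- exact: subset_trans sM (subsetUl _ _).
- by rewrite setUC cardsU1 eNM; lia.
have sub : uncovered M0 (M :|: [set e]) \subset
    uncovered M0 M :\: [set s in uncovered M0 M | e \in Abs s].
  apply/subsetP => s; rewrite [s \in _]inE => /forall_inP us.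
  have eD : e \in (M :|: [set e]) :\: M0.
    by rewrite !inE eqxx orbT andbT; apply: contra eNM; apply: (subsetP sM).
  rewrite in_setD [in X in _ && X]inE [in X in X && _]inE (negPf (us e eD)) andbF /=.
  apply/forall_inP => f; rewrite inE => /andP[f0 fM]; apply: us.
  by rewrite !inE f0 fM.
have := subset_leq_card sub; rewrite cardsD.
have -> : uncovered M0 M :&: [set s in uncovered M0 M | e \in Abs s] =
    [set s in uncovered M0 M | e \in Abs s].
  by apply/setIidPr/subsetP => s; rewrite inE => /andP[].
move: uM pe; set u := #|uncovered M0 M|; set v := #|[set _ in _ | _]|.
set w := #|uncovered _ _| => uM pe wuv.
have step : 2 * c * w <= (2 * c).-1 * u by nia.
rewrite !expnS.
have := leq_mul (leqnn ((2 * c) ^ t)) step.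
have := leq_mul (leqnn (2 * c).-1) uM.
nia.
Qed.

Lemma cover_all (M0 : {set vec}) (t : nat) :
  vmatching H M0 -> 2 * c * (k * (#|M0| + t)) <= #|T| ->
  (2 * c).-1 ^ t * #|Cfg| < (2 * c) ^ t ->
  exists M, [/\ vmatching H M, M0 \subset M, #|M| <= #|M0| + t &
    forall s, exists2 e, e \in M :\: M0 & e \in Abs s].
Proof.
move=> mM0 bt lt; have [M [mM sM cM uM]] := cover_iter mM0 bt.
exists M; split=> // s.
have [|U0] := posnP #|uncovered M0 M|.
  move/eqP; rewrite cards_eq0 => /eqP U0.
  have : s \notin uncovered M0 M by rewrite U0 inE.
  rewrite inE negb_forall_in => /exists_inP[e eM]; rewrite negbK => es.
  by exists e.
have := leq_ltn_trans uM lt.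
by rewrite -[X in _ < X]muln1 ltn_mul2l => /andP[_]; lia.
Qed.

End Covering.

(** * Absorbers *)

Section Absorbing.
Variables (k : nat) (T : finType) (H : {set {ffun 'I_k -> T}}) (d : nat).
Variables o0 o1 o2 : 'I_k.
Hypotheses (o01 : o0 != o1) (o02 : o0 != o2) (o12 : o1 != o2).
Hypotheses (codegH : codeg_ge H d) (T_gt0 : 0 < #|T|).
Local Notation vec := {ffun 'I_k -> T}.

(** Two disjoint vectors made of [e] and the uncovered vectors [s] and [y]: the
    first uses all of [s] but its [o0]-th vertex, the second two vertices of
    [y].  The vertices left over are one in each part. *)
Definition absorber_pair (e s y : vec) : vec * vec :=
  (upd s o0 (e o0), upd (upd e o0 (y o0)) o1 (y o1)).

Definition absorbers (s y : vec) : {set vec} :=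
  [set e in H | ((absorber_pair e s y).1 \in H) &&
                ((absorber_pair e s y).2 \in H)].

(** The vertices of an absorber can be chosen one after the other: first
    coordinate [o0], then all others but [o1] and [o2] freely, then [o2] and
    finally [o1]; each of the three conditions leaves [d] choices for the
    coordinate that it concerns. *)
Lemma card_absorbers s y : d ^ 3 * #|T| ^ k <= #|T| ^ 3 * #|absorbers s y|.
Proof.
pose Q0 := [set e : vec | upd s o0 (e o0) \in H].
pose Q2 := [set e : vec | upd (upd e o0 (y o0)) o1 (y o1) \in H].
have o10 : o1 != o0 by rewrite eq_sym.
have o20 : o2 != o0 by rewrite eq_sym.
have o21 : o2 != o1 by rewrite eq_sym.
have E0 : d * #|T| ^ k <= #|T| * #|Q0|.
  have := @fiber_ge _ _ setT Q0 o0 d.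
  rewrite cardsT card_ffun card_ord setTI; apply=> [f x _|f _]; first by rewrite inE.
  apply: leq_trans (codegH s o0) _; apply: subset_leq_card.
  by apply/subsetP => x; rewrite !inE upd_at.
have E1 : d * #|Q0| <= #|T| * #|Q0 :&: Q2|.
  apply: (@fiber_ge _ _ _ _ o2) => [f x|f _].
    by rewrite !inE upd_ne.
  apply: leq_trans (codegH (upd (upd f o0 (y o0)) o1 (y o1)) o2) _.
  apply: subset_leq_card; apply/subsetP => x; rewrite !inE.
  by rewrite (updC _ _ _ o12) (updC _ _ _ o02).
have E2 : d * #|Q0 :&: Q2| <= #|T| * #|(Q0 :&: Q2) :&: H|.
  apply: (@fiber_ge _ _ _ _ o1) => [f x|f _]; last exact: codegH.
  by rewrite !inE upd_ne // -(updC _ _ _ o01) upd_upd (updC _ _ _ o01).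
have -> : absorbers s y = (Q0 :&: Q2) :&: H.
  by apply/setP => e; rewrite !inE /= andbC.
rewrite !(expnSr _ 2) !(expnSr _ 1) !expn1.
have := leq_mul (leqnn (d * d)) E0; have := leq_mul (leqnn (d * #|T|)) E1.
have := leq_mul (leqnn (#|T| * #|T|)) E2; rewrite !mulnA.
move: (#|T| ^ k) #|T| #|Q0| #|_| #|_| => u n a b z; lia.
Qed.

(** [Q] repairs a shortage of [p] edges.  The first alternative is there
    because absorption needs two uncovered vertices in each part. *)
Definition absorbing (Q : {set vec}) (p : nat) : Prop :=
  forall M, vmatching H M -> Q \subset M ->
  exists2 M', vmatching H M' & (#|T| <= #|M'| + 1) || (#|M| + p <= #|M'|).

Lemma absorb_one (M : {set vec}) e s y :
  vmatching H M -> e \in M -> e \in absorbers s y ->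
  (forall i, s i \notin cov M i) -> (forall i, y i \notin cov M i) ->
  (forall i, s i != y i) ->
  exists M', [/\ vmatching H M', M :\ e \subset M' & #|M'| = #|M| + 1].
Proof.
move=> mM eM; rewrite inE => /and3P[eH f1H f2H] sM yM sy.
set f1 := (absorber_pair e s y).1 in f1H.
set f2 := (absorber_pair e s y).2 in f2H.
have o10 : o1 != o0 by rewrite eq_sym.
have ne i : f1 i != f2 i.
  have es : e i != s i by apply: contraNneq (sM i) => <-; apply: mem_cov.
  have ey : e i != y i by apply: contraNneq (yM i) => <-; apply: mem_cov.
  rewrite /f1 /f2 /= !updE.
  have [Ei|i0] := eqVneq i o0; first by rewrite -Ei Ei (negPf o01) -Ei.
  by have [Ei|i1] := eqVneq i o1; rewrite -?Ei // eq_sym.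
have m12 : vmatching H [set f1; f2].
  apply/vmatchingP; split; first by rewrite subUset !sub1set f1H.
  move=> i f g; rewrite !inE => /orP[]/eqP-> /orP[]/eqP-> //= /eqP.
    by rewrite (negPf (ne i)).
  by rewrite eq_sym (negPf (ne i)).
have sD : [set e] \subset M by rewrite sub1set.
have eN j : e j \notin cov (M :\: [set e]) j.
  by apply: notin_covD mM sD _; rewrite inE.
have out x j : x \notin cov M j -> x \notin cov (M :\: [set e]) j.
  by apply: contra; apply: subsetP; apply: cov_sub; apply: subsetDl.
have k0 : 0 < k by case: (o0) => m; apply: leq_ltn_trans.
have [|mR cR] := vmatching_swap k0 mM sD m12.
  move=> f j /set2P[]->; rewrite /f1 /f2 /= !updE.
    by case: eqP => [->|_]; rewrite ?eN ?out.
  case: eqP => [->|_]; first by rewrite out.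
  by case: eqP => [->|_]; rewrite ?eN ?out.
exists ((M :\ e) :|: [set f1; f2]); split=> //; first exact: subsetUl.
have f12 : f1 != f2 by apply: contra (ne o0) => /eqP->.
by move: cR; rewrite cards1 cards2 f12 /=; move: #|_| #|_| => a b; clear; lia.
Qed.

(** [Q] is the union of [p] disjoint layers, each of which serves all pairs of
    vectors.  Absorbing once uses up an edge of one layer only, and leaves the
    other layers intact for the vertices that are uncovered afterwards. *)
Lemma absorbing_exists c t p :
  #|T| ^ 3 <= c * d ^ 3 ->
  (2 * c).-1 ^ t * #|T| ^ (2 * k) < (2 * c) ^ t ->
  2 * c * (k * (p * t)) <= #|T| ->
  exists Q, [/\ vmatching H Q, #|Q| <= p * t & absorbing Q p].
Proof.
move=> cd ct; elim: p => [|p IH] bp.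
  exists set0; split; rewrite ?vmatching0 ?cards0 // => M mM _.
  by exists M => //; rewrite addn0 leqnn orbT.
have k0 : 0 < k by case: (o0) => m; apply: leq_ltn_trans.
have [|Q [mQ cQ aQ]] := IH; first by nia.
have abH (sy : vec * vec) : absorbers sy.1 sy.2 \subset H.
  by apply/subsetP => e; rewrite inE => /andP[].
have abC (sy : vec * vec) : #|T| ^ k <= c * #|absorbers sy.1 sy.2|.
  have h := card_absorbers sy.1 sy.2.
  have n0 : 0 < #|T| ^ 3 by rewrite expn_gt0 T_gt0.
  rewrite -(leq_pmul2l n0).
  apply: leq_trans (leq_mul cd (leqnn _)) _.
  by rewrite -mulnA [leqRHS]mulnCA leq_mul2l h orbT.
have [||Q' [mQ' sQ cQ' coverQ]] := cover_all (t := t) k0 T_gt0 abH abC mQ.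
- by apply: leq_trans bp; rewrite !leq_mul2l (mulSn p) [t + _]addnC leq_add2r cQ !orbT.
- by rewrite card_prod card_ffun card_ord -expnD addnn -mul2n.
exists Q'; split=> //; first by apply: leq_trans cQ' _; rewrite mulSn addnC leq_add2l.
move=> M mM sM.
have [small|big] := leqP #|T| (#|M| + 1); first by exists M; rewrite ?small.
have room (i : 'I_k) : #|{: bool}| <= #|~: cov M i|.
  rewrite card_bool; have := cardsC (cov M i); rewrite (card_cov i mM).
  by move: big; clear; lia.
have [s [sL sI]] := disjoint_vectors room.
have [e eQ eA] := coverQ (s true, s false).
move: eQ; rewrite inE => /andP[eQ eQ'].
have out b i : s b i \notin cov M i by have := sL b i; rewrite inE.
have [|M1 [mM1 sM1 cM1]] := absorb_one mM (subsetP sM e eQ') eA (out _) (out _).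
  by move=> i; apply/eqP => /sI.
have [|M2 mM2 cM2] := aQ M1 mM1.
  apply: subset_trans sM1; apply/subsetP => f fQ.
  rewrite !inE (subsetP sM) ?(subsetP sQ) // andbT.
  by apply: contraNneq eQ => <-.
exists M2 => //; case/orP: cM2 => [->//|h]; apply/orP; right.
by apply: leq_trans h; rewrite cM1 -addnA add1n.
Qed.

End Absorbing.

(** * A maximum matching that is too small exposes a sparse set *)

Lemma sum_card_disjoint (I U : finType) (F : I -> {set U}) (M : {set U}) :
  (forall i, F i \subset M) ->
  (forall i j e, e \in F i -> e \in F j -> i = j) ->
  #|M :\: \bigcup_i F i| + \sum_i #|F i| = #|M|.
Proof.
move=> FM dF.
have -> : \sum_i #|F i| = #|\bigcup_i F i|.
  rewrite -sum1_card partition_disjoint_bigcup => [|i j ij].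
    by apply: eq_bigr => i _; rewrite sum1_card.
  rewrite disjoint_subset; apply/subsetP => e ei; rewrite inE.
  by apply: contra ij => ej; apply/eqP/(dF i j e).
have /setIidPr sub : \bigcup_i F i \subset M by apply/bigcupsP.
by rewrite -[RHS](cardsID (\bigcup_i F i)) sub addnC.
Qed.

Lemma sum_ord_ge k d (F : 'I_k -> nat) :
  (forall i, d <= F i) -> k * d <= \sum_(i < k) F i.
Proof. by move=> dF; rewrite -[X in X * d]card_ord -sum_nat_const leq_sum. Qed.

Lemma sum_ord_le k d (F : 'I_k -> nat) :
  (forall i, F i <= d) -> \sum_(i < k) F i <= k * d.
Proof. by move=> dF; rewrite -[X in X * d]card_ord -sum_nat_const leq_sum. Qed.

Section Structure.
Variables (k : nat) (T : finType) (H : {set {ffun 'I_k -> T}}) (d r : nat).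
Hypotheses (k_gt0 : 0 < k) (codegH : codeg_ge H d) (kd : #|T| <= k * d + 1).
Local Notation vec := {ffun 'I_k -> T}.
Variables Q M : {set vec}.
Hypotheses (mQ : vmatching H Q) (cQ : #|Q| <= r).
Hypotheses (mM : vmatching H M) (bM : inbox (fun i => ~: cov Q i) M).
Hypothesis maxM : forall N, vmatching H N ->
  inbox (fun i => ~: cov Q i) N -> #|N| <= #|M|.
Local Notation L i := (~: (cov Q i :|: cov M i)).
Variable s : 'I_k * 'I_k -> vec.
Hypotheses (sL : forall a i, s a i \in L i).
Hypothesis (sI : forall a b i, s a i = s b i -> a = b).

Lemma gain_bound (D N : {set vec}) :
  D \subset M -> vmatching H N ->
  (forall e j, e \in N -> e j \in L j \/ exists2 m, m \in D & e j = m j) ->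
  #|N| <= #|D|.
Proof.
move=> sDM mN hN; apply: (max_no_gain k_gt0 mM bM maxM sDM mN).
  apply/inboxP => e j eN; have [|[m mD ->]] := hN e j eN.
    by rewrite !inE negb_or => /andP[].
  by apply: (inboxP _ _ bM); apply: (subsetP sDM).
move=> e j eN; have [|[m mD ->]] := hN e j eN; last exact: notin_covD mM sDM mD.
rewrite !inE negb_or => /andP[_]; apply: contra; apply: subsetP.
by apply: cov_sub; apply: subsetDl.
Qed.

(* The second index provides [k] interchangeable copies of each leftover vector;
   they are used simultaneously in [sparse_part_independent]. *)
Local Notation hit i t := [set e in M | upd (s (i, t)) i (e i) \in H].

Lemma leftover_notin e i : e \in M -> e i \notin L i.
Proof. by move=> eM; rewrite !inE negbK (mem_cov i eM) orbT. Qed.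

Lemma leftover_ne e a i : e \in M -> e i != s a i.
Proof. by move=> /leftover_notin-/(_ i); apply: contraNneq => ->. Qed.

(** An edge hit at two different coordinates would be replaced by two edges. *)
Lemma hit_disjoint i j t t' e : e \in hit i t -> e \in hit j t' -> i = j.
Proof.
rewrite !inE => /andP[eM h1] /andP[_ h2]; apply/eqP/negPn/negP => ij.
set e1 := upd _ i _ in h1; set e2 := upd _ j _ in h2.
have ne l : e1 l != e2 l.
  rewrite /e1 /e2 !updE; have [El|li] := eqVneq l i.
    by rewrite El (negPf ij) leftover_ne.
  have [El|lj] := eqVneq l j; first by rewrite El eq_sym leftover_ne.
  by apply: contra ij => /eqP/sI[->].
have e12 : e1 != e2 by apply: contra (ne i) => /eqP->.
suff: #|[set e1; e2]| <= #|[set e]| by rewrite cards1 cards2 e12.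
apply: gain_bound; first by rewrite sub1set.
  apply/vmatchingP; split; first by rewrite subUset !sub1set h1.
  move=> l f g; rewrite !inE => /orP[]/eqP-> /orP[]/eqP-> //= /eqP.
    by rewrite (negPf (ne l)).
  by rewrite eq_sym (negPf (ne l)).
move=> f l /set2P[]->; rewrite /e1 /e2 updE; case: eqP => [->|_].
- by right; exists e; rewrite ?inE.
- by left.
- by right; exists e; rewrite ?inE.
- by left.
Qed.

Lemma hit_large i t : d <= #|hit i t| + r.
Proof.
apply: leq_trans (codegH (s (i, t)) i) _.
rewrite addnC; apply: (@leq_trans (#|cov Q i| + #|cov (hit i t) i|)); last first.
  by rewrite (card_cov i mQ) leq_add // leq_imset_card.
apply: leq_trans (leq_card_setU _ _); apply: subset_leq_card.
apply/subsetP => x; rewrite inE => xH; rewrite inE.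
apply/orP; have [|xQ] := boolP (x \in cov Q i); first by left.
have [/covP[e eM xe]|xM] := boolP (x \in cov M i).
  by right; rewrite xe; apply: mem_cov; rewrite inE eM -xe.
suff: #|[set upd (s (i, t)) i x]| <= #|(set0 : {set vec})|.
  by rewrite cards1 cards0.
apply: gain_bound; rewrite ?sub0set ?vmatching1 // => f j /set1P->; left.
by rewrite updE; case: eqP => [->|_] //; rewrite !inE negb_or xQ.
Qed.

Lemma sum_hits t : k * d <= \sum_(i < k) #|hit i t| + k * r.
Proof.
apply: leq_trans (sum_ord_ge (fun i => hit_large i t)) _.
by rewrite big_split /= sum_nat_const card_ord.
Qed.

Lemma card_unhit t : #|M :\: \bigcup_i hit i t| <= k * r + 1.
Proof.
have hM i : hit i t \subset M by apply/subsetP => e; rewrite inE => /andP[].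
have := sum_card_disjoint hM (fun i j e => @hit_disjoint i j t t e).
have := sum_hits t.
have : #|M| <= #|T| by rewrite -(card_cov (Ordinal k_gt0) mM) max_card.
by move: #|_ :\: _| (\sum_(i < k) _) #|M| #|T| kd; clear; lia.
Qed.

(** The copies for coordinate [i] hit nearly the same edges: whatever they hit
    is missed by the leftover vectors of the other coordinates, and these
    already account for nearly all of [M] but [d] edges. *)
Lemma card_hits i : #|\bigcup_t hit i t| + k.-1 * d <= #|M| + k.-1 * r.
Proof.
pose F j := if j == i then \bigcup_t hit i t else hit j i.
have FM j : F j \subset M.
  rewrite /F; case: eqP => _; last by apply/subsetP => e; rewrite inE => /andP[].
  by apply/bigcupsP => t _; apply/subsetP => e; rewrite inE => /andP[].
have dF j l e : e \in F j -> e \in F l -> j = l.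
  have Fhit m : e \in F m -> exists t, e \in hit m t.
    rewrite /F; case: eqP => [->|_ em]; last by exists i.
    by case/bigcupP => t _ et; exists t.
  by move=> /Fhit[t h1] /Fhit[t' h2]; apply: hit_disjoint h1 h2.
have := sum_card_disjoint FM dF.
have Fi : F i = \bigcup_t hit i t by rewrite /F eqxx.
rewrite [X in _ + X](bigD1 i) //= Fi.
have : k.-1 * d <= \sum_(j < k | j != i) #|F j| + k.-1 * r.
  have c1 : #|[pred j : 'I_k | j != i]| = k.-1 by rewrite cardC1 card_ord.
  rewrite -c1 -!sum_nat_const -big_split /=; apply: leq_sum => j ji.
  by rewrite /F (negPf ji) hit_large.
by move: #|_ :\: _| #|\bigcup_t _| (\sum_(j < k | _) _) #|M|; clear; lia.
Qed.

Lemma card_leftover i : #|L i| <= k * r + 1.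
Proof.
have t := Ordinal k_gt0.
have h : #|cov M i| <= #|cov Q i :|: cov M i| by rewrite subset_leq_card ?subsetUr.
have hM j : hit j t \subset M by apply/subsetP => e; rewrite inE => /andP[].
have := sum_card_disjoint hM (fun i j e => @hit_disjoint i j t t e).
have := sum_hits t.
have := cardsC (cov Q i :|: cov M i); rewrite (card_cov i mM) in h.
by move: #|_ :\: _| (\sum_(i < k) _) #|M| #|~: _| #|_ :|: _| #|T| kd h; clear; lia.
Qed.

(** The requirement for every [t] is what allows several edges of [M] to be
    traded at once, each with its own copy of the leftover vectors. *)
Definition sparse_part i : {set T} :=
  cov ((M :\: \bigcup_t hit i t) :\: \bigcup_t (M :\: \bigcup_j hit j t)) i.

Lemma card_sparse_part i :
  #|~: sparse_part i| <= d + (k * k + 2 * k) * r + k + 2.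
Proof.
set Z := \bigcup_t hit i t; set Y := \bigcup_t (M :\: \bigcup_j hit j t).
have sub : ~: sparse_part i \subset L i :|: (cov Q i :|: cov (Z :|: Y) i).
  apply/subsetP => x; rewrite !in_setU in_setC.
  have [xQ|xQ] := boolP (x \in cov Q i); first by rewrite orbT.
  have [/covP[e eM ->]|xM] := boolP (x \in cov M i); last first.
    by rewrite in_setC in_setU negb_or xQ xM.
  move=> nB; apply/orP; right; apply/orP; right; apply: mem_cov.
  apply: contraR nB; rewrite in_setU negb_or => /andP[eZ eY].
  by apply: mem_cov; rewrite !in_setD eY eZ.
have cY : #|Y| <= k * (k * r + 1).
  apply: leq_trans (card_bigcup_le _) _.
  by apply: sum_ord_le => t; apply: card_unhit.
have cZ := card_hits i; rewrite -/Z in cZ.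
have cL := card_leftover i.
have cM : #|M| <= #|T| by rewrite -(card_cov (Ordinal k_gt0) mM) max_card.
apply: leq_trans (subset_leq_card sub) _.
apply: leq_trans (leq_card_setU _ _) _.
apply: leq_trans (leq_add cL (leq_card_setU _ _)) _.
rewrite (card_cov i mQ).
have : #|cov (Z :|: Y) i| <= #|Z| + #|Y|.
  by apply: leq_trans (leq_imset_card _ _) _; apply: leq_card_setU.
move: cQ cY cZ kd cM k_gt0; move: #|cov _ _| #|Z| #|Y| #|T| #|M| #|Q|.
move: k => [|m] //; rewrite succnK => z y q t u v; clear.
nia.
Qed.

(** An edge inside the sparse parts meets matching edges each of which has
    another vertex [x] that completes a leftover vector; trading all of them
    for the completed leftover vectors and that edge would gain one edge. *)
Lemma sparse_part_independent f : f \in H -> exists i, f i \notin sparse_part i.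
Proof.
move=> fH; apply/existsP; rewrite -negb_forall; apply/negP => /forallP fB.
have /fin_all_exists2[phi phiG phif] i : exists2 e,
    e \in (M :\: \bigcup_t hit i t) :\: \bigcup_t (M :\: \bigcup_j hit j t) &
    f i = e i.
  exact/covP.
have phiM i : phi i \in M by have := phiG i; rewrite !inE; case/and3P.
pose D := [set phi i | i : 'I_k].
have sDM : D \subset M by apply/subsetP => e /imsetP[i _ ->].
(* The edge [e] of [D] is traded using the copies with second index [tau e],
   hence different edges use disjoint leftover vectors. *)
have /fin_all_exists[tau tauP] e : exists t, e \in D -> phi t = e.
  have [/imsetP[t _ ->]|] := boolP (e \in D); first by exists t.
  by exists (Ordinal k_gt0).
have /fin_all_exists[eta etaP] e : exists j, e \in D -> e \in hit j (tau e).
  have [eD|] := boolP (e \in D); last by exists (Ordinal k_gt0).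
  have [i _ Ei] := imsetP eD.
  have := phiG i; rewrite -Ei inE => /andP[/bigcupP nY _].
  have : e \in \bigcup_j hit j (tau e).
    apply/negPn/negP => ne; apply: nY; exists (tau e) => //.
    by rewrite inE ne (subsetP sDM).
  by case/bigcupP => j _ ej; exists j.
pose E e := upd (s (eta e, tau e)) (eta e) (e (eta e)).
have EE e e' l : e \in D -> e' \in D -> E e l = E e' l -> e = e'.
  move=> eD e'D; have [eM e'M] := (subsetP sDM e eD, subsetP sDM e' e'D).
  rewrite /E !updE; have [El|ne] := eqVneq l (eta e).
    rewrite -El; have [El'|ne'] := eqVneq l (eta e').
      by rewrite -El'; apply: vmatching_inj mM eM e'M.
    by move/eqP; rewrite (negPf (leftover_ne _ _ eM)).
  have [El'|ne'] := eqVneq l (eta e').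
    by rewrite -El' => /esym/eqP; rewrite (negPf (leftover_ne _ _ e'M)).
  by case/sI => _ tt; rewrite -(tauP e eD) -(tauP e' e'D) tt.
have fE e l : e \in D -> f l != E e l.
  move=> eD; have eM := subsetP sDM e eD.
  rewrite /E updE phif; have [El|ne] := eqVneq l (eta e); last first.
    exact: leftover_ne.
  rewrite -El; apply/eqP => /(vmatching_inj mM (phiM l) eM) pe.
  have := phiG l; rewrite pe inE => /andP[_]; rewrite inE => /andP[/bigcupP nh _].
  by apply: nh; exists (tau e) => //; rewrite El; apply: etaP.
have cN : #|f |: [set E e | e in D]| = #|D|.+1.
  rewrite cardsU1 card_in_imset; last first.
    move=> e e' eD e'D /ffunP/(_ (Ordinal k_gt0)); exact: EE.
  suff -> : f \notin [set E e | e in D] by [].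
  apply/imsetP => -[e eD fe]; have := fE e (Ordinal k_gt0) eD.
  by rewrite fe eqxx.
suff: #|f |: [set E e | e in D]| <= #|D| by rewrite cN ltnn.
apply: gain_bound => //.
  apply/vmatchingP; split.
    rewrite subUset sub1set fH; apply/subsetP => g /imsetP[e eD ->].
    by have := etaP e eD; rewrite inE => /andP[].
  move=> l g g' /setU1P[->|/imsetP[e eD ->]] /setU1P[->|/imsetP[e' e'D ->]] //=.
  - by move/eqP; rewrite (negPf (fE _ _ e'D)).
  - by move/esym/eqP; rewrite (negPf (fE _ _ eD)).
  - by move/EE => ->.
move=> g l /setU1P[->|/imsetP[e eD ->]].
  by right; exists (phi l); rewrite ?phif // imset_f.
rewrite /E updE; case: eqP => [->|_]; first by right; exists e.
by left; apply: sL.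
Qed.

End Structure.

Section Dichotomy.
Variables (k : nat) (T : finType) (H : {set {ffun 'I_k -> T}}) (d r : nat).
Hypotheses (k_gt0 : 0 < k) (codegH : codeg_ge H d) (kd : #|T| <= k * d + 1).
Local Notation vec := {ffun 'I_k -> T}.

Definition independent (B : 'I_k -> {set T}) : Prop :=
  forall f, f \in H -> exists i, f i \notin B i.

(** The constant [k * k] is the number of disjoint leftover vectors needed: one
    for each coordinate and each copy. *)
Lemma large_matching_or_sparse (Q : {set vec}) :
  vmatching H Q -> #|Q| <= r ->
  (exists M, [/\ vmatching H M, Q \subset M & #|T| <= #|M| + k * k]) \/
  (exists2 B, independent B &
     forall i, #|~: B i| <= d + (k * k + 2 * k) * r + k + 2).
Proof.
move=> mQ cQ.
have [M [mM bM maxM]] := exists_max_vmatching H (fun i => ~: cov Q i).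
have mQM : vmatching H (Q :|: M).
  by apply: vmatchingU => // e j eM; have := inboxP _ _ bM e j eM; rewrite inE.
have [small|big] := leqP #|T| (#|Q :|: M| + k * k).
  by left; exists (Q :|: M); rewrite subsetUl.
right.
have room i : #|{: 'I_k * 'I_k}| <= #|~: (cov Q i :|: cov M i)|.
  rewrite card_prod card_ord -covU.
  have := cardsC (cov (Q :|: M) i); rewrite (card_cov i mQM).
  by move: big; clear; lia.
have [s [sL sI]] := disjoint_vectors room.
exists (sparse_part H M s).
  move=> f fH; exact: (sparse_part_independent k_gt0 mM bM maxM sL sI fH).
move=> i; exact: (card_sparse_part k_gt0 codegH kd mQ cQ mM bM maxM sL sI).
Qed.

End Dichotomy.

(** * Perfect matchings of nearly complete blocks *)

Lemma ordS_neq k (j : 'I_k) : 1 < k -> ordS j != j.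
Proof.
move=> k1; apply/eqP => /(congr1 val) /=.
have [lt|ge] := ltnP j.+1 k; first by rewrite modn_small //; lia.
have -> : j.+1 = k by have := ltn_ord j; lia.
by rewrite modnn; have := ltn_ord j; lia.
Qed.

(** The three kinds of unsuitable families in [mixing_family] cannot exhaust all
    [u = m ^ k] families of [k] edges of a matching of size [m]. *)
Lemma mixing_count k rho m u b1 b2 b3 :
  2 * (k * k + k * rho) < m -> 0 < u -> 2 * b1 <= u -> m * b2 <= k * k * u ->
  m * b3 <= k * (rho * u) -> u <= b1 + (b2 + b3) -> False.
Proof.
move=> hm u0 h1 h2 h3 h.
have : 2 * (k * k + k * rho) * u < m * u by rewrite ltn_mul2r u0.
have := leq_mul (leqnn m) h1; have := leq_mul (leqnn (2 * m)) h.
lia.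
Qed.

Section Block.
Variables (k : nat) (T : finType) (H : {set {ffun 'I_k -> T}}).
Variables (X : 'I_k -> {set T}) (i0 : 'I_k) (a rho q : nat).
Local Notation vec := {ffun 'I_k -> T}.
Hypothesis k_gt1 : 1 < k.
Hypothesis Xa : forall j, a <= #|X j|.
Hypothesis miss_vector : forall f : vec, (forall j, j != i0 -> f j \in X j) ->
  #|[set v in X i0 | upd f i0 v \notin H]| <= rho.
Hypothesis miss_vertex : forall v, v \in X i0 ->
  2 * q ^ k * #|[set f : vec | [forall j, (j != i0) ==> (f j \in X j)] &&
                               (upd f i0 v \notin H)]| <= #|T| ^ k.
Hypothesis Tq : #|T| <= q * (a - rho).
Hypothesis rho_small : 2 * (k * k + k * rho) < a - rho.

Section Maximal.
Variable M : {set vec}.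
Hypotheses (mM : vmatching H M) (bM : inbox X M).
Hypothesis maxM : forall N, vmatching H N -> inbox X N -> #|N| <= #|M|.
Variable x : vec.
Hypothesis xX : forall j, x j \in X j :\: cov M j.
Hypothesis ltMa : #|M| < a.

Let k_gt0 : 0 < k := ltnW k_gt1.
Local Notation edge := {e : vec | e \in M}.

(** The uncovered vertices of part [i0] all miss the uncovered vector [x]. *)
Lemma max_block_large : a - rho <= #|M|.
Proof.
have sub : X i0 :\: cov M i0 \subset [set v in X i0 | upd x i0 v \notin H].
  apply/subsetP => v; rewrite in_setD => /andP[vM vX].
  rewrite inE vX /=; apply/negP => xH.
  suff: #|[set upd x i0 v]| <= #|(set0 : {set vec})| by rewrite cards1 cards0.
  have bx j : upd x i0 v j \in X j :\: cov M j.
    by rewrite updE; case: eqP => [->|_] //; rewrite in_setD vM.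
  apply: (max_no_gain k_gt0 mM bM maxM); rewrite ?sub0set ?vmatching1 //.
    by apply/inboxP => f j /set1P->; have := bx j; rewrite in_setD; case/andP.
  by move=> f j /set1P->; have := bx j; rewrite setD0 in_setD => /andP[].
have xin j : j != i0 -> x j \in X j by have := xX j; rewrite in_setD => /andP[].
have := leq_trans (subset_leq_card sub) (miss_vector xin).
have := cardsD (X i0) (cov M i0); have := Xa i0.
have : #|X i0 :&: cov M i0| <= #|M|.
  by rewrite -(card_cov i0 mM) subset_leq_card // subsetIr.
by clear; lia.
Qed.

(** The vectors [mix phi] and [shifted phi j] use the vertices of the [k] edges
    [phi j] and the uncovered vector [x], each once: [mix phi] takes the
    diagonal, except that [x i0] stands at [i0], and for [j] other than [i0]
    the vector [shifted phi j] has [x j] in the gap that this leaves in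
    [phi j].  The vertices of part [i0] are moved on cyclically, because
    nothing is known about how the old vertex of [phi j] fits the modified
    edge. *)
Definition mix (phi : {ffun 'I_k -> edge}) : vec :=
  [ffun j => if j == i0 then x i0 else val (phi j) j].

Definition shifted (phi : {ffun 'I_k -> edge}) (j : 'I_k) : vec :=
  upd (upd (val (phi j)) j (x j)) i0 (val (phi (ordS j)) i0).

(** A family chosen at random is suitable: [mix phi] is an edge because [x i0]
    misses a small proportion of the vectors, [phi] is injective because [M] is
    large, and [shifted phi j] is an edge because, once all but its vertex in
    part [i0] is fixed, at most [rho] of the choices for that vertex fail. *)
Lemma mixing_family : exists phi : {ffun 'I_k -> edge},
  [/\ forall j l, phi j = phi l -> j = l, mix phi \in H & forall j, shifted phi j \in H].
Proof.
pose bad1 := [set phi | mix phi \notin H].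
pose bad2 (p : 'I_k * 'I_k) := [set phi : {ffun 'I_k -> edge} |
  (p.1 != p.2) && (phi p.1 == phi p.2)].
pose bad3 j := [set phi | shifted phi j \notin H].
set m := #|M|; have cm : #|{: edge}| = m by rewrite card_sig.
have xin j : x j \in X j by have := xX j; rewrite in_setD => /andP[].
have large := max_block_large.
have m0 : 0 < m by move: rho_small large; rewrite /m; clear; lia.
have c1 : 2 * #|bad1| <= m ^ k.
  pose g (phi : {ffun 'I_k -> edge}) : vec := [ffun j => val (phi j) j].
  have gI : injective g.
    move=> phi psi /ffunP gg; apply/ffunP => j; apply: val_inj.
    have := gg j; rewrite !ffunE.
    exact: vmatching_inj mM (valP (phi j)) (valP (psi j)).
  have := miss_vertex (xin i0); rewrite -(card_imset _ gI).
  set Z := [set f | _ && _] => cZ.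
  have sub : g @: bad1 \subset Z.
    apply/subsetP => f /imsetP[phi]; rewrite inE => mixH ->; rewrite inE.
    apply/andP; split.
      apply/forallP => j; apply/implyP => _; rewrite ffunE.
      exact: (inboxP _ _ bM _ _ (valP (phi j))).
    suff -> : upd (g phi) i0 (x i0) = mix phi by [].
    by apply/ffunP => j; rewrite !ffunE.
  have q0 : 0 < q ^ k.
    by rewrite expn_gt0; case: (q) Tq cm m0 => // /[swap] _; rewrite mul0n;
       have := max_card (cov M i0); rewrite (card_cov i0 mM) -/m; clear; lia.
  rewrite -(leq_pmul2l q0) mulnA [q ^ k * 2]mulnC.
  apply: leq_trans (leq_trans _ cZ) _.
    by rewrite leq_mul2l subset_leq_card ?orbT.
  rewrite -expnMn leq_exp2r //; apply: leq_trans Tq _.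
  by rewrite leq_mul2l large orbT.
have c2 : m * #|\bigcup_p bad2 p| <= k * k * m ^ k.
  apply: leq_trans (_ : m * \sum_p #|bad2 p| <= _).
    by rewrite leq_mul2l card_bigcup_le orbT.
  rewrite big_distrr /=.
  have -> : k * k * m ^ k = \sum_(p : 'I_k * 'I_k) m ^ k.
    by rewrite sum_nat_const card_prod card_ord.
  apply: leq_sum => -[j l] _.
  rewrite -[m]cm -[leqRHS]mul1n; apply: (@fiber_le _ _ _ j) => phi.
  have [->|jl] := eqVneq j l.
    by rewrite (_ : [set _ | _] = set0) ?cards0 //; apply/setP => e; rewrite !inE eqxx.
  rewrite -(cards1 (phi l)); apply: subset_leq_card; apply/subsetP => e.
  by rewrite !inE /= upd_at upd_ne 1?eq_sym // => /andP[].
have c3 : m * #|\bigcup_j bad3 j| <= k * (rho * m ^ k).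
  apply: leq_trans (_ : m * \sum_j #|bad3 j| <= _).
    by rewrite leq_mul2l card_bigcup_le orbT.
  rewrite big_distrr /=; apply: sum_ord_le => j.
  rewrite -[m]cm; apply: (@fiber_le _ _ _ (ordS j)) => phi.
  have fin l : l != i0 -> upd (val (phi j)) j (x j) l \in X l.
    move=> li; rewrite updE; case: eqP => [->|_] //.
    exact: (inboxP _ _ bM _ _ (valP (phi j))).
  apply: leq_trans (miss_vector fin).
  have vI : injective (fun e : edge => val e i0).
    by move=> e e' ee; apply/val_inj/(vmatching_inj mM (valP e) (valP e') ee).
  rewrite -(card_imset _ vI); apply: subset_leq_card.
  apply/subsetP => v /imsetP[e]; rewrite !inE => eH ->.
  rewrite (inboxP _ _ bM _ _ (valP e)) /=.
  by move: eH; rewrite /shifted upd_at upd_ne // eq_sym ordS_neq.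
pose bad := bad1 :|: (\bigcup_p bad2 p :|: \bigcup_j bad3 j).
have [phi phiG] : exists phi, phi \notin bad.
  apply/existsP; rewrite -negb_forall; apply/negP => /forallP all.
  have : m ^ k <= #|bad1| + (#|\bigcup_p bad2 p| + #|\bigcup_j bad3 j|).
    apply: (@leq_trans #|bad|); last first.
      apply: leq_trans (leq_card_setU _ _) _.
      by rewrite leq_add2l leq_card_setU.
    have <- : #|{: {ffun 'I_k -> edge}}| = m ^ k by rewrite card_ffun cm card_ord.
    apply: subset_leq_card.
    by apply/subsetP => phi _; apply: all.
  have u0 : 0 < m ^ k by rewrite expn_gt0 m0.
  exact: (mixing_count (leq_trans rho_small large) u0 c1 c2 c3).
move: phiG; rewrite !inE !negb_or => /and3P[n1 n2 n3].
exists phi; split.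
- move=> j l jl; apply/eqP/negPn/negP => ne.
  by case/negP: n2; apply/bigcupP; exists (j, l); rewrite // inE ne jl /=.
- by rewrite negbK in n1.
move=> j; apply/negPn/negP => nj; case/negP: n3.
by apply/bigcupP; exists j; rewrite ?inE.
Qed.

(** Trading the [k] edges of a suitable family for [mix phi] and the [k] shifted
    vectors gains one edge. *)
Lemma block_not_maximal : False.
Proof.
have [phi [phiI mixH shH]] := mixing_family.
have phiM j : val (phi j) \in M by apply: valP.
have vI j l : val (phi j) = val (phi l) -> j = l by move/val_inj/phiI.
have eqM j l i : val (phi j) i = val (phi l) i -> j = l.
  by move/(vmatching_inj mM (phiM j) (phiM l))/vI.
have xin j : x j \in X j by have := xX j; rewrite in_setD => /andP[].
have xout j l : x j != val (phi l) j.
  apply: contraTneq (xX j) => ->; rewrite in_setD mem_cov //.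
pose D := [set val (phi j) | j : 'I_k].
have cD : #|D| = k by rewrite card_imset ?card_ord // => j l /vI.
have shI j j' l : shifted phi j l = shifted phi j' l -> j = j'.
  rewrite /shifted !updE; case: (l =P i0) => [_|_].
    by move=> e; apply: ordS_inj; apply: eqM e.
  have [Ej|nj] := eqVneq l j; have [Ej'|nj'] := eqVneq l j'; subst => //.
  - by move/eqP; rewrite (negPf (xout _ _)).
  - by move/esym/eqP; rewrite (negPf (xout _ _)).
  - exact: eqM.
have mixN j l : mix phi l != shifted phi j l.
  rewrite /mix ffunE /shifted !updE; case: (l =P i0) => [_|_]; first exact: xout.
  have [Ej|nj] := eqVneq l j; first by rewrite eq_sym Ej xout.
  by apply: contra nj => /eqP/eqM ->.
pose N := mix phi |: [set shifted phi j | j : 'I_k].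
have cN : #|N| = k.+1.
  rewrite cardsU1 card_imset ?card_ord => [|j l jl]; last first.
    exact: (shI j l i0 (congr1 (fun f : vec => f i0) jl)).
  suff -> : mix phi \notin [set shifted phi j | j : 'I_k] by [].
  by apply/imsetP => -[j _ jm]; have := mixN j i0; rewrite jm eqxx.
suff : #|N| <= #|D| by rewrite cN cD ltnn.
apply: (max_no_gain k_gt0 mM bM maxM).
- by apply/subsetP => e /imsetP[j _ ->].
- apply/vmatchingP; split.
    by rewrite subUset sub1set mixH; apply/subsetP => e /imsetP[j _ ->].
  move=> l f g /setU1P[->|/imsetP[j _ ->]] /setU1P[->|/imsetP[j' _ ->]] //=.
  + by move/eqP; rewrite (negPf (mixN _ _)).
  + by move/esym/eqP; rewrite (negPf (mixN _ _)).
  + by move/shI->.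
- apply/inboxP => f l /setU1P[->|/imsetP[j _ ->]].
    by rewrite ffunE; case: eqP => [->|_] //; apply: (inboxP _ _ bM).
  rewrite /shifted !updE; case: eqP => [->|_]; first exact: (inboxP _ _ bM).
  by case: eqP => [->|_] //; apply: (inboxP _ _ bM).
have outx l : x l \notin cov (M :\: D) l.
  have := xX l; rewrite in_setD => /andP[+ _]; apply: contra.
  by apply: subsetP; apply: cov_sub; apply: subsetDl.
have sDM : D \subset M by apply/subsetP => e /imsetP[j _ ->].
have outD j l : val (phi j) l \notin cov (M :\: D) l.
  by apply: notin_covD mM sDM _; apply: imset_f.
move=> f l /setU1P[->|/imsetP[j _ ->]].
  by rewrite ffunE; case: eqP => [->|_].
rewrite /shifted !updE; case: eqP => [->|_] //.
by case: eqP => [->|_].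
Qed.

End Maximal.

(** A common bound [rho] on what a vector misses does not suffice here, since a
    single vertex of part [i0] could still be isolated; this is why
    [miss_vertex] bounds what each vertex misses, too. *)
Lemma block_matching : #|X i0| = a ->
  exists M, [/\ vmatching H M, inbox X M & #|M| = a].
Proof.
move=> cX0; have [M [mM bM maxM]] := exists_max_vmatching H X.
exists M; split=> //.
have le : #|M| <= a.
  rewrite -(card_cov i0 mM) -cX0; apply: subset_leq_card.
  by apply/subsetP => v /covP[e eM ->]; apply: (inboxP _ _ bM).
apply/eqP; rewrite eqn_leq le leqNgt; apply/negP => lt.
have room j : #|{: unit}| <= #|X j :\: cov M j|.
  rewrite card_unit; have := cardsD (X j) (cov M j); have := Xa j.
  have : #|X j :&: cov M j| <= #|M|.
    by rewrite -(card_cov j mM) subset_leq_card // subsetIr.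
  by move: lt; clear; lia.
have [s [sX _]] := disjoint_vectors room.
exact: (block_not_maximal mM bM maxM (sX tt)).
Qed.

End Block.

(** * The sparse case *)

Lemma exchange_count (I J : finType) (A : {set I}) (B : {set J})
    (R : I -> J -> bool) :
  \sum_(i in A) #|[set j in B | R i j]| = \sum_(j in B) #|[set i in A | R i j]|.
Proof.
under eq_bigr => i _ do rewrite -sum1_card.
under [RHS]eq_bigr => j _ do rewrite -sum1_card.
rewrite (exchange_big_dep (mem B)) /= => [|i j _]; last first.
  by rewrite inE => /andP[].
by apply: eq_bigr => j jB; apply: eq_bigl => i; rewrite !inE jB.
Qed.

Section Extremal.
Variables (k : nat) (T : finType) (H : {set {ffun 'I_k -> T}}) (d rho : nat).
Variable B : 'I_k -> {set T}.
Local Notation vec := {ffun 'I_k -> T}.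
Implicit Types (f e : vec) (i j : 'I_k) (v : T).
Hypotheses (k_gt1 : 1 < k) (T_gt0 : 0 < #|T|).
Hypotheses (codegH : codeg_ge H d) (indB : independent H B).
Hypotheses (cB : forall i, #|~: B i| <= d + rho) (B_half : forall i, #|T| <= 2 * #|B i|).

(** Coordinate [i] is unconstrained, so all counts below carry a common factor
    [#|T|] in comparison with counts of vectors without that coordinate. *)
Definition box i : {set vec} := [set f : vec | [forall j, (j != i) ==> (f j \in B j)]].

Definition link i v : {set vec} := [set f in box i | upd f i v \in H].

(** The threshold is as low as [1 / (rho + 2)] so that even if the vertices
    outside [B i] exceed [d] by [rho], at least [d] of them pass it. *)
Definition heavy i : {set T} :=
  [set v in ~: B i | #|box i| <= (rho + 2) * #|link i v|].

Definition weak theta i : {set T} :=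
  [set v in ~: B i | #|box i| < theta * #|box i :\: link i v|].

Lemma boxP i f : reflect (forall j, j != i -> f j \in B j) (f \in box i).
Proof.
rewrite inE; apply: (iffP forallP) => h j; first exact/implyP.
by apply/implyP; apply: h.
Qed.

Lemma box_large i : #|T| ^ k <= 2 ^ k * #|box i|.
Proof.
pose F j : {set T} := if j == i then setT else B j.
have -> : #|box i| = \prod_(j < k) #|F j|.
  transitivity #|family F|; last by rewrite card_family foldrE big_map big_enum.
  apply: eq_card => f; rewrite inE; apply: eq_forallb => j.
  change (((j != i) ==> (f j \in B j)) = (f j \in F j)).
  by rewrite /F; case: eqP; rewrite ?in_setT.
have -> : 2 ^ k = \prod_(j < k) 2 by rewrite prod_nat_const card_ord.
have -> : #|T| ^ k = \prod_(j < k) #|T| by rewrite prod_nat_const card_ord.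
rewrite -big_split /=; apply: leq_prod => j _; rewrite /F.
by case: eqP => // _; rewrite cardsT leq_pmull.
Qed.

Lemma box_gt0 i : 0 < #|box i|.
Proof.
have := box_large i; have : 0 < #|T| ^ k by rewrite expn_gt0 T_gt0.
by case: #|box i| => //; rewrite muln0; clear; lia.
Qed.

(** A vertex of [B i] would complete the vector to an edge inside [B]. *)
Lemma box_degree i f : f \in box i -> d <= #|[set v in ~: B i | upd f i v \in H]|.
Proof.
move=> /boxP fB; apply: leq_trans (codegH f i) _.
apply: subset_leq_card; apply/subsetP => v; rewrite !inE => vH.
rewrite vH andbT; apply/negP => vB; have [j] := indB vH.
by rewrite updE; case: eqP => [->|/eqP/fB->] //; rewrite vB.
Qed.

Lemma box_missing i f : f \in box i ->
  #|[set v in ~: B i | upd f i v \notin H]| <= rho.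
Proof.
move=> /box_degree deg.
have := cardsID [set v | upd f i v \in H] (~: B i).
rewrite -(leq_add2l d); move: (cB i).
have -> : ~: B i :&: [set v | upd f i v \in H] = [set v in ~: B i | upd f i v \in H].
  by apply/setP => v; rewrite !inE.
have -> : ~: B i :\: [set v | upd f i v \in H] = [set v in ~: B i | upd f i v \notin H].
  by apply/setP => v; rewrite !inE andbC.
by move: deg; move: #|_| #|_| #|_| => x y z; clear; lia.
Qed.

Lemma heavy_ge i : d <= #|heavy i|.
Proof.
have e1 : d * #|box i| <= \sum_(v in ~: B i) #|link i v|.
  rewrite /link -(exchange_count _ _ (fun (f : vec) v => upd f i v \in H)).
  by rewrite mulnC -sum_nat_const; apply: leq_sum => f; apply: box_degree.
have hA : heavy i \subset ~: B i by apply/subsetP => v; rewrite inE => /andP[].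
have e2 : (rho + 2) * \sum_(v in ~: B i) #|link i v| <=
    #|heavy i| * ((rho + 2) * #|box i|) + #|~: B i :\: heavy i| * #|box i|.
  rewrite (big_setID (heavy i)) /= (setIidPr hA) mulnDr !big_distrr /=.
  rewrite -!sum_nat_const; apply: leq_add; apply: leq_sum => v.
    by rewrite leq_mul2l subset_leq_card ?orbT // /link setIdE subsetIl.
  by rewrite !inE => /andP[+ vB]; rewrite vB /= -ltnNge => /ltnW.
have e3 := subset_leq_card hA; have e4 := cardsD (~: B i) (heavy i).
rewrite (setIidPr hA) in e4; rewrite e4 in e2.
have e5 := leq_trans (leq_mul (leqnn (rho + 2)) e1) e2.
have e6 : (rho + 2) * d <= #|heavy i| * (rho + 2) + (#|~: B i| - #|heavy i|).
  by rewrite -(leq_pmul2r (box_gt0 i)) [leqRHS]mulnDl -mulnA -[X in _ <= X + _]mulnA.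
move: #|heavy i| #|~: B i| (cB i) e3 e6; clear => h a c3 e3 e6.
by rewrite leqNgt; apply/negP => lt; nia.
Qed.

Lemma not_heavy_le i : #|~: B i :\: heavy i| <= rho.
Proof.
have hA : heavy i \subset ~: B i by apply/subsetP => v; rewrite inE => /andP[].
rewrite cardsD (setIidPr hA); move: (heavy_ge i) (cB i).
by move: #|_| #|_| => x y; clear; lia.
Qed.

Lemma weak_le theta i : #|weak theta i| <= theta * rho.
Proof.
have e1 : \sum_(v in ~: B i) #|box i :\: link i v| <= rho * #|box i|.
  rewrite (eq_bigr (fun v => #|[set f in box i | upd f i v \notin H]|)); last first.
    move=> v _; apply: eq_card => f; rewrite in_setD !in_set.
    by case: [forall j, _] => /=; rewrite ?andbT ?andbF.
  rewrite -(exchange_count _ _ (fun (f : vec) v => upd f i v \notin H)).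
  by rewrite mulnC -sum_nat_const; apply: leq_sum => f; apply: box_missing.
have wA : weak theta i \subset ~: B i by apply/subsetP => v; rewrite inE => /andP[].
have e2 : #|weak theta i| * #|box i| <= theta * \sum_(v in ~: B i) #|box i :\: link i v|.
  rewrite (big_setID (weak theta i)) /= (setIidPr wA) mulnDr -sum_nat_const.
  apply: leq_trans (leq_addr _ _); rewrite big_distrr /=; apply: leq_sum => v.
  by rewrite inE => /andP[_ /ltnW].
rewrite -(leq_pmul2r (box_gt0 i)) -mulnA; apply: leq_trans e2 _.
by rewrite leq_mul2l e1 orbT.
Qed.

Lemma heavy_notin i v : v \in heavy i -> v \notin B i.
Proof. by rewrite !inE => /andP[]. Qed.

Variables (s theta q : nat).
Hypotheses (s_d : s < d) (s_B : forall i, s < #|B i|).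
Hypothesis s_T : k * s * ((rho + 2) * 2 ^ k) < #|T|.

Definition heavy_count (e : vec) : nat := #|[set j | e j \in heavy j]|.

Definition free (M : {set vec}) (e : vec) : Prop := forall j, e j \notin cov M j.

Lemma free_vertex (M : {set vec}) (i : 'I_k) (U : {set T}) :
  vmatching H M -> #|M| < #|U| -> exists2 x, x \in U & x \notin cov M i.
Proof.
move=> mM lt; have : 0 < #|U :\: cov M i|.
  rewrite cardsD subn_gt0; apply: leq_ltn_trans lt.
  by rewrite -(card_cov i mM) subset_leq_card // subsetIr.
by case/card_gt0P => x; rewrite inE => /andP[xM xU]; exists x.
Qed.

Lemma free_light_vector (M : {set vec}) :
  vmatching H M -> #|M| <= s -> exists f, free M f /\ forall j, f j \in B j.
Proof.
move=> mM cM.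
have /fin_all_exists2[f fB fM] i : exists2 x, x \in B i & x \notin cov M i.
  by apply: free_vertex mM _; apply: leq_ltn_trans (s_B i).
by exists [ffun i => f i]; split=> j; rewrite ffunE.
Qed.

Lemma heavy_count_le e (J : {set 'I_k}) :
  (forall j, j \notin J -> e j \notin heavy j) -> heavy_count e <= #|J|.
Proof.
move=> eJ; apply: subset_leq_card; apply/subsetP => j; rewrite inE.
by apply: contraLR => /eJ.
Qed.

(** A heavy vertex is completed by vertices of [B] only, which its many edges
    allow.  For any other vertex the codegree condition provides the last
    vertex, and it does not matter whether that one is heavy. *)
Lemma cover_vertex (M : {set vec}) i v :
  vmatching H M -> #|M| <= s -> v \notin cov M i ->
  exists e, [/\ e \in H, e i = v, free M e & heavy_count e <= 1].
Proof.
move=> mM cM vM; have [vh|vnh] := boolP (v \in heavy i).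
  pose Hit := [set f : vec | [exists j, f j \in cov M j]].
  have hit : #|T| * #|Hit| <= k * s * #|T| ^ k.
    by apply: card_hitting => j; rewrite (card_cov j mM).
  have /subsetPn[f] : ~~ (link i v \subset Hit).
    apply/negP => /subset_leq_card sub; move: vh; rewrite inE => /andP[_ vh].
    have := leq_trans (box_large i) (leq_mul (leqnn _) vh).
    have u0 : 0 < #|T| ^ k by rewrite expn_gt0 T_gt0.
    move=> h; have := s_T; rewrite ltnNge => /negP; apply.
    rewrite -(leq_pmul2r u0).
    apply: leq_trans (leq_mul (leqnn #|T|) h) _.
    have := leq_mul (leqnn ((rho + 2) * 2 ^ k)) hit.
    have := leq_mul (leqnn ((rho + 2) * 2 ^ k * #|T|)) sub.
    move: #|T| (#|T| ^ k) (2 ^ k) #|link i v| #|Hit|; clear => n u w x y; lia.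
  rewrite !inE => /andP[/forallP fB fH]; rewrite negb_exists => /forallP fM.
  exists (upd f i v); split=> //; first exact: upd_at.
    by move=> j; rewrite updE; case: eqP => [->|_].
  rewrite -(cards1 i); apply: heavy_count_le => j; rewrite inE => ji.
  by rewrite upd_ne //; apply: contraL (implyP (fB j) ji); apply: heavy_notin.
have [f [fM fB]] := free_light_vector mM cM.
pose j := ordS i; have ji : j != i by apply: ordS_neq.
have [|w wH wM] := @free_vertex M j [set w | upd (upd f i v) j w \in H] mM.
  by apply: leq_ltn_trans cM _; apply: leq_trans s_d (codegH _ _).
exists (upd (upd f i v) j w); split.
- by rewrite inE in wH.
- by rewrite upd_ne 1?eq_sym // upd_at.
- move=> l; rewrite !updE; case: eqP => [->|_] //.
  by case: eqP => [->|_].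
rewrite -(cards1 j); apply: heavy_count_le => l; rewrite inE => lj.
rewrite upd_ne // updE; case: eqP => [->|_] //.
by apply: contraL (fB l); apply: heavy_notin.
Qed.

(** The size that [M] reaches when every uncovered heavy vertex gets an edge of
    its own.  It should be [#|T|] or [#|T| - 1]: if it is larger there are not
    enough vertices of [B], and if it is smaller the result is too small. *)
Definition weight (M : {set vec}) := \sum_(i < k) #|heavy i :\: cov M i| + #|M|.

Lemma add_edge (M : {set vec}) e :
  vmatching H M -> e \in H -> free M e ->
  [/\ vmatching H (M :|: [set e]), #|M :|: [set e]| = #|M| + 1 &
      weight (M :|: [set e]) + heavy_count e = weight M + 1].
Proof.
move=> mM eH eM; have k_gt0 := ltnW k_gt1.
have dis f j : f \in [set e] -> f j \notin cov M j by move=> /set1P->.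
have cU : #|M :|: [set e]| = #|M| + 1 by rewrite cardU_uncovered // cards1.
split=> //; first by apply: vmatchingU; rewrite ?vmatching1.
rewrite /weight cU addnAC -[RHS]addnA; congr (_ + _).
have -> : heavy_count e = \sum_(j < k) (e j \in heavy j).
  by rewrite /heavy_count -sum1dep_card big_mkcond /=;
     apply: eq_bigr => j _; case: (_ \in _).
rewrite -big_split /=; apply: eq_bigr => j _.
rewrite covU cov_set1 (cardsD1 (e j) (heavy j :\: cov M j)) in_setD eM /= addnC.
congr (_ + _); apply: eq_card => x; rewrite !inE negb_or.
by rewrite -andbA andbCA.
Qed.

Lemma cover_vertices (D : seq ('I_k * T)) :
  #|T| <= k * d + 1 -> size D <= s ->
  exists M, [/\ vmatching H M, #|M| <= size D, #|T| <= weight M + 1 &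
    forall p, p \in D -> p.2 \in cov M p.1].
Proof.
move=> kd; elim: D => [|[i v] D IH] /= sD.
  exists set0; split; rewrite ?vmatching0 ?cards0 //.
  rewrite /weight cards0 addn0; apply: leq_trans kd _; rewrite leq_add2r.
  by apply: sum_ord_ge => i; rewrite cov0 setD0 heavy_ge.
have [M [mM cM wM covM]] := IH (ltnW sD).
have [vM|vM] := boolP (v \in cov M i).
  exists M; split=> //; first exact: leqW.
  by move=> p; rewrite inE => /orP[/eqP->|/covM].
have [e [eH ev eM he]] := cover_vertex mM (leq_trans cM (ltnW sD)) vM.
have [mM' cM' wM'] := add_edge mM eH eM.
exists (M :|: [set e]); split=> //.
- by rewrite cM' addn1 ltnS.
- by move: (weight (_ :|: _)) (weight M) (heavy_count e) #|T| wM wM' he; clear; lia.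
move=> p; rewrite inE covU inE => /orP[/eqP->|/covM->] //=.
by rewrite cov_set1 -ev set11 orbT.
Qed.

Variables o0 o1 o2 : 'I_k.
Hypotheses (o01 : o0 != o1) (o02 : o0 != o2) (o12 : o1 != o2).

(** Two heavy vertices can be prescribed, and the codegree condition chooses the
    last vertex.  Such an edge lowers the weight by one or two, and the two
    admissible values are consecutive, so it cannot jump over both. *)
Lemma two_or_three_heavy (M : {set vec}) :
  vmatching H M -> #|M| <= s ->
  exists e, [/\ e \in H, free M e & 2 <= heavy_count e <= 3].
Proof.
move=> mM cM; have [f [fM fB]] := free_light_vector mM cM.
have hv i : exists2 x, x \in heavy i & x \notin cov M i.
  apply: free_vertex mM _; apply: leq_ltn_trans cM _.
  exact: leq_trans s_d (heavy_ge i).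
have [x xh xM] := hv o0; have [y yh yM] := hv o1.
pose g := upd (upd f o0 x) o1 y.
have [|w wH wM] := @free_vertex M o2 [set w | upd g o2 w \in H] mM.
  by apply: leq_ltn_trans cM _; apply: leq_trans s_d (codegH _ _).
exists (upd g o2 w); split; first by rewrite inE in wH.
  move=> l; rewrite !updE; case: eqP => [->|_] //.
  by case: eqP => [->|_] //; case: eqP => [->|_].
apply/andP; split.
  have -> : 2 = #|[set o0; o1]| by rewrite cards2 o01.
  apply: subset_leq_card; apply/subsetP => j /set2P[]->; rewrite inE.
    by rewrite upd_ne // upd_ne // upd_at.
  by rewrite upd_ne // upd_at.
have -> : 3 = #|[set o0; o1; o2]|.
  by rewrite setUC cardsU1 cards2 o01 !inE negb_or ![o2 == _]eq_sym o02 o12.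
apply: heavy_count_le => j; rewrite in_setU in_set2 in_set1 !negb_or -andbA => /and3P[j0 j1 j2].
by rewrite /g !upd_ne //; apply: contraL (fB j); apply: heavy_notin.
Qed.

Lemma balance_weight t (M : {set vec}) :
  vmatching H M -> #|M| + t <= s -> #|T| <= weight M + 1 -> weight M <= #|T| + t ->
  exists M', [/\ vmatching H M', M \subset M', #|M'| <= s &
    weight M' <= #|T| <= weight M' + 1].
Proof.
elim: t M => [|t IH] M mM cM wM wt.
  by exists M; split=> //; rewrite ?wM ?andbT -1?[#|T|]addn0 // -[#|M|]addn0.
have [small|big] := leqP (weight M) #|T|.
  by exists M; split=> //; [apply: leq_trans cM; apply: leq_addr | rewrite small].
have [|e [eH eM he]] := two_or_three_heavy mM.
  by apply: leq_trans cM; apply: leq_addr.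
have [mM' cM' wM'] := add_edge mM eH eM.
have [||||M2 [m2 s2 c2 w2]] := IH (M :|: [set e]) => //.
- by rewrite cM' -addnA add1n.
- by move: (weight (_ :|: _)) (weight M) (heavy_count e) #|T| big wM' he; clear; lia.
- by move: (weight (_ :|: _)) (weight M) (heavy_count e) #|T| wt wM' he; clear; lia.
by exists M2; split=> //; apply: subset_trans s2; apply: subsetUl.
Qed.

Hypothesis theta_q : theta = 2 * q ^ k.
Hypothesis q_T : #|T| <= q * (d - s - rho).
Hypothesis rho_small : 2 * (k * k + k * rho) < d - s - rho.

(** Because the weight is at most [#|T|], each part [j] other than [i] has at
    least as many uncovered vertices in [B j] as part [i] has uncovered heavy
    ones; hence the block lemma applies.  The weight does not change, as each
    edge of the block covers exactly one heavy vertex. *)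
Lemma complete_part (M : {set vec}) (i : 'I_k) :
  vmatching H M -> weight M <= #|T| -> d - s <= #|heavy i :\: cov M i| ->
  (forall j v, v \notin B j -> v \notin cov M j -> v \in heavy j) ->
  (forall j v, v \in weak theta j -> v \in cov M j) ->
  exists N, [/\ vmatching H (M :|: N), weight (M :|: N) = weight M,
    heavy i \subset cov (M :|: N) i &
    forall j, j != i -> heavy j :\: cov (M :|: N) j = heavy j :\: cov M j].
Proof.
move=> mM wM large hM kM; set a := #|heavy i :\: cov M i|.
pose X j := if j == i then heavy i :\: cov M i else B j :\: cov M j.
have Xi : X i = heavy i :\: cov M i by rewrite /X eqxx.
have XB j : j != i -> X j = B j :\: cov M j by rewrite /X => /negPf->.
have XM j : X j \subset ~: cov M j.
  by rewrite /X setDE; case: eqP => [->|_]; rewrite ?setDE subsetIr.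
have Xa j : a <= #|X j|.
  have [->|ji] := eqVneq j i; first by rewrite Xi.
  rewrite XB //.
  have part : ~: cov M j \subset (B j :\: cov M j) :|: (heavy j :\: cov M j).
    apply/subsetP => v; rewrite in_setC => vM; rewrite in_setU !in_setD vM /=.
    by have [//|vB] := boolP (v \in B j); rewrite (hM j v).
  have := leq_trans (subset_leq_card part) (leq_card_setU _ _).
  have := cardsC (cov M j); rewrite (card_cov j mM).
  move: wM; rewrite /weight (bigD1 j) //= (bigD1 i) /=; last by rewrite eq_sym.
  rewrite -/a; move: (\sum_(l | _) _) a #|_ :\: _| #|_ :\: _| #|M| #|~: _| #|T|.
  by clear; lia.
have [|||||N [mN bN cN]] := @block_matching k T H X i a rho q k_gt1 Xa.
- move=> f fX; rewrite Xi; apply: leq_trans (box_missing (_ : f \in box i)).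
    apply: subset_leq_card; apply/subsetP => v; rewrite !inE.
    by case/andP => /and3P[_ -> _] ->.
  by apply/boxP => j ji; have := fX j ji; rewrite XB // inE => /andP[].
- move=> v; rewrite Xi inE => /andP[vM vh].
  have vw : v \notin weak theta i by apply: contra vM; apply: kM.
  have : theta * #|box i :\: link i v| <= #|box i|.
    by move: vw vh; rewrite !in_set => + /andP[vB _]; rewrite vB -leqNgt.
  rewrite -theta_q => h.
  have le : #|box i| <= #|T| ^ k.
    by apply: leq_trans (max_card _) _; rewrite card_ffun card_ord.
  apply: leq_trans (leq_trans h le); rewrite leq_mul2l; apply/orP; right.
  apply: subset_leq_card; apply/subsetP => f; rewrite !inE => /andP[/forallP fX fH].
  rewrite (negPf fH) andbF /=; apply/forallP => j; apply/implyP => ji.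
  by have := implyP (fX j) ji; rewrite XB // inE => /andP[].
- apply: leq_trans q_T _; rewrite leq_mul2l; apply/orP; right.
  by rewrite leq_sub2r.
- by apply: leq_trans rho_small _; rewrite leq_sub2r.
- by rewrite Xi.
have dNM e j : e \in N -> e j \notin cov M j.
  by move=> eN; have := subsetP (XM j) _ (inboxP _ _ bN e j eN); rewrite inE.
have NX j : cov N j \subset X j.
  by apply/subsetP => v /covP[e eN ->]; apply: (inboxP _ _ bN).
have Ni : cov N i = heavy i :\: cov M i.
  by apply/eqP; rewrite eqEcard -Xi NX (card_cov i mN) cN Xi leqnn.
have Nj j : j != i -> heavy j :\: cov (M :|: N) j = heavy j :\: cov M j.
  move=> ji; apply/setP => v; rewrite covU !in_setD in_setU negb_or.
  have [vN|_] := boolP (v \in cov N j); last by rewrite andbT.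
  have := subsetP (NX j) v vN; rewrite XB // inE => /andP[_ vB].
  by rewrite andbF /=; symmetry; apply/negP => /andP[_ /heavy_notin]; rewrite vB.
have hi : heavy i \subset cov (M :|: N) i.
  by rewrite covU Ni; apply/subsetP => v vh; rewrite in_setU in_setD vh andbT orbN.
exists N; split=> //; first exact: vmatchingU.
rewrite /weight cardU_uncovered //; last exact: ltnW.
rewrite (bigD1 i) //= [in RHS](bigD1 i) //= -/a cN.
have -> : heavy i :\: cov (M :|: N) i = set0 by apply/eqP; rewrite setD_eq0.
rewrite cards0 (eq_bigr (fun j => #|heavy j :\: cov M j|)) => [|j ji]; last by rewrite Nj.
by rewrite add0n addnA addnC addnA.
Qed.

Lemma complete_parts (M : {set vec}) (l : seq 'I_k) :
  vmatching H M -> #|M| <= s -> weight M <= #|T| ->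
  (forall j v, v \notin B j -> v \notin cov M j -> v \in heavy j) ->
  (forall j v, v \in weak theta j -> v \in cov M j) ->
  exists M', [/\ vmatching H M', M \subset M', weight M' = weight M,
    (forall i, i \in l -> heavy i \subset cov M' i) &
    forall i, heavy i \subset cov M' i \/
              heavy i :\: cov M' i = heavy i :\: cov M i].
Proof.
move=> mM cM wM hM kM; elim: l => [|i l [M1 [m1 s1 w1 l1 e1]]].
  by exists M; split=> // i; right.
have [full|Ei] := e1 i.
  by exists M1; split=> // j; rewrite inE => /orP[/eqP->|/l1].
have cov1 j v : v \in cov M j -> v \in cov M1 j.
  by apply: subsetP; apply: cov_sub.
have [||||N [mN wN iN jN]] := @complete_part M1 i m1.
- by rewrite w1.
- rewrite Ei cardsD; have := heavy_ge i.
  have : #|heavy i :&: cov M i| <= #|M|.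
    by rewrite -(card_cov i mM) subset_leq_card // subsetIr.
  by move: cM; clear; lia.
- by move=> j v vB vM; apply: hM vB _; apply: contra vM; apply: cov1.
- by move=> j v vw; apply: cov1; apply: kM.
have mono j : heavy j \subset cov M1 j -> heavy j \subset cov (M1 :|: N) j.
  by move=> h; apply: subset_trans h _; rewrite covU subsetUl.
exists (M1 :|: N); split=> //.
- exact: subset_trans s1 (subsetUl _ _).
- by rewrite wN.
- by move=> j; rewrite inE => /orP[/eqP->|/l1/mono].
move=> j; have [->|ji] := eqVneq j i; first by left.
by have [/mono|Ej] := e1 j; [left | right; rewrite jN].
Qed.

Hypotheses (kd : #|T| <= k * d + 1) (kd' : k * d <= #|T| + k).
Hypothesis s_large : 2 * (k * (rho + theta * rho)) + k + k * rho <= s.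

(** Once all heavy vertices are covered the weight is the size of the matching. *)
Theorem sparse_large_matching : exists2 M, vmatching H M & #|T| <= #|M| + 1.
Proof.
pose bad i := (~: B i :\: heavy i) :|: weak theta i.
pose D := enum [set p : 'I_k * T | p.2 \in bad p.1].
have sizeD : size D <= k * (rho + theta * rho).
  rewrite -cardE -sum1dep_card.
  rewrite (eq_bigl (fun p => true && (p.2 \in bad p.1))) //.
  rewrite -(pair_big_dep xpredT (fun i v => v \in bad i) (fun _ _ => 1)) /=.
  apply: sum_ord_le => i; rewrite sum1_card.
  apply: leq_trans (leq_card_setU _ _) _.
  exact: leq_add (not_heavy_le i) (weak_le theta i).
have [|M1 [m1 c1 w1 cov1]] := @cover_vertices D kd.
  by apply: leq_trans sizeD _; move: s_large; clear; lia.
have c1' := leq_trans c1 sizeD.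
have covbad i v : v \in bad i -> v \in cov M1 i.
  by move=> vb; apply: (cov1 (i, v)); rewrite mem_enum inE.
pose t := k + k * rho + k * (rho + theta * rho).
have [||M2 [m2 s2 c2 /andP[w2 w2']]] := @balance_weight t M1 m1 _ w1.
- by move: c1' s_large; rewrite /t; clear; lia.
- rewrite /weight.
  have : \sum_(i < k) #|heavy i :\: cov M1 i| <= k * (d + rho).
    apply: sum_ord_le => i; apply: leq_trans (cB i).
    apply: subset_leq_card; apply: subset_trans (subsetDl _ _) _.
    by apply/subsetP => v; rewrite inE => /andP[].
  by rewrite /t; move: (\sum_(i < k) _) #|M1| #|T| c1' kd'; clear; lia.
have covbad2 i v : v \in bad i -> v \in cov M2 i.
  by move=> /covbad; apply: subsetP; apply: cov_sub.
have [||M3 [m3 s3 w3 l3 _]] := @complete_parts M2 (enum 'I_k) m2 c2 w2.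
- move=> j v vB; apply: contraR => vh; apply: covbad2.
  by rewrite in_setU in_setD in_setC vB vh.
- by move=> j v vw; apply: covbad2; rewrite in_setU vw orbT.
exists M3 => //; apply: leq_trans w2' _; rewrite -w3 /weight big1 ?add0n //.
move=> i _; apply/eqP; rewrite cards_eq0 setD_eq0; apply: l3.
by rewrite mem_enum.
Qed.

End Extremal.

(** * Orders of magnitude *)

Lemma cube_le_exp2 l : l.+1 ^ 3 <= 16 * 2 ^ l.
Proof.
have [small|] := ltnP l 4; first by move: l small => [|[|[|[|l]]]].
elim: l => // l IH; rewrite leq_eqVlt => /orP[/eqP<-//|l4].
have {}IH := IH l4; rewrite [2 ^ l.+1]expnS.
have : l.+2 ^ 3 <= 2 * l.+1 ^ 3 by rewrite !(expnSr _ 2) !(expnSr _ 1) !expn1; nia.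
by move: (l.+2 ^ 3) (l.+1 ^ 3) (2 ^ l) IH; clear; lia.
Qed.

Lemma log_square_le K : exists n0, forall n, n0 <= n ->
  K * ((trunc_log 2 n).+1 * (trunc_log 2 n).+1) <= n.
Proof.
exists (2 ^ (16 * K)) => n le.
have l0 : 16 * K <= trunc_log 2 n by apply: trunc_log_max.
have n0 : 0 < n by apply: leq_trans le; rewrite expn_gt0.
apply: leq_trans (trunc_logP (isT : 1 < 2) n0).
have := cube_le_exp2 (trunc_log 2 n).
move: (trunc_log 2 n) l0 => l l0; rewrite !(expnSr _ 2) !(expnSr _ 1) expn1.
move: (2 ^ l) => u; move: l0; clear => l0 h.
have : 16 * K * (l.+1 * l.+1) <= l.+1 * (l.+1 * l.+1) by rewrite leq_mul2r; lia.
lia.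
Qed.

(** Bernoulli's inequality for [(1 + 1 / m) ^ j], cleared of denominators. *)
Lemma bernoulli m j : m ^ j * (m + j) <= m.+1 ^ j * m.
Proof.
elim: j => [|j IH]; first by rewrite !expn0 addn0.
rewrite !expnS; have := leq_mul (leqnn m.+1) IH.
by move: (m ^ j) (m.+1 ^ j) => u v; clear; nia.
Qed.

(** As [(1 - 1 / (m + 1)) ^ (m + 1)] is at most [1 / 2], logarithmically many
    steps of [cover_iter] serve all configurations. *)
Lemma decay m l N : 0 < m -> N < 2 ^ l ->
  m ^ (m.+1 * l) * N < m.+1 ^ (m.+1 * l).
Proof.
move=> m0 Nl; rewrite !expnM.
have h : m ^ m.+1 * 2 <= m.+1 ^ m.+1.
  rewrite -(leq_pmul2r m0); apply: leq_trans (bernoulli m m.+1).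
  by rewrite -mulnA leq_mul2l; apply/orP; right; clear; lia.
apply: (@leq_trans ((m ^ m.+1) ^ l * 2 ^ l)).
  by rewrite ltn_mul2l Nl expn_gt0 expn_gt0 m0.
by rewrite -expnMn; case: l {Nl} => // l; rewrite leq_exp2r.
Qed.

Lemma codeg_ge_le k (T : finType) (H : {set {ffun 'I_k -> T}}) d d' :
  d' <= d -> codeg_ge H d -> codeg_ge H d'.
Proof. by move=> le cH f i; apply: leq_trans (cH f i). Qed.

Lemma sparse_large_matching_num k (T : finType) (H : {set {ffun 'I_k -> T}})
    d rho s B :
  2 < k -> codeg_ge H d -> #|T| <= k * d + 1 -> k * d <= #|T| + k ->
  independent H B -> (forall i, #|~: B i| <= d + rho) ->
  2 * (k * (rho + 2 * (4 * k) ^ k * rho)) + k + k * rho <= s ->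
  k * s * ((rho + 2) * 2 ^ k) < #|T| ->
  4 * (k * (s + rho + 2 * (k * k + k * rho))) + 4 < #|T| ->
  exists2 M, vmatching H M & #|T| <= #|M| + 1.
Proof.
move=> k3 cH kd kd' iB cB hs hT hW.
have k1 : 1 < k := ltnW k3.
have T0 : 0 < #|T| by apply: leq_ltn_trans hW.
have big : 4 * k + 6 * rho + 4 * s < #|T|.
  apply: leq_ltn_trans hW; move: k3; clear; nia.
have d3 : 3 * d <= #|T| + k by apply: leq_trans kd'; rewrite leq_mul2r k3 orbT.
have sum_lt : s + rho + 2 * (k * k + k * rho) < d.
  rewrite -(ltn_pmul2l (ltnW k1)).
  by move: (s + _ + _) #|T| kd hW => X n; move: (k * X) (k * d); clear; lia.
have cBge i : #|T| <= 2 * #|B i|.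
  have := cardsC (B i); have := cB i.
  by move: #|B i| #|~: B i| #|T| big d3; clear; lia.
apply: (@sparse_large_matching k T H d rho B k1 T0 cH iB cB cBge s
  (2 * (4 * k) ^ k) (4 * k) _ _ hT
  (Ordinal (ltnW k1)) (Ordinal k1) (Ordinal k3)) => //.
- by move: sum_lt; clear; lia.
- by move=> i; have := cBge i; move: #|B i| #|T| big; clear; lia.
- have : k * (s + rho) <= k * (s + rho + 2 * (k * k + k * rho)).
    by rewrite leq_mul2l leq_addr orbT.
  rewrite -subnDA -mulnA mulnBr; move: #|T| kd hW => n.
  by move: (k * d) (k * (s + rho)) (k * (_ + _)); clear; lia.
- by move: sum_lt; clear; lia.
Qed.

Theorem near_perfect_vmatching k : 2 < k -> exists n0, forall n, n0 <= n ->
  forall (T : finType) (H : {set {ffun 'I_k -> T}}) d,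
  #|T| = n -> codeg_ge H d -> n <= k * d + 1 ->
  exists2 M, vmatching H M & n <= #|M| + 1.
Proof.
move=> k3; have k1 := ltnW k3; have k0 := ltnW k1.
(* [1 / c] is the proportion of absorbers among all vectors; [t0], [rho0] and [s0]
   are the factors of [log n] in the size of a layer of absorbers, in the error
   term of the sparse case, and in the number of edges chosen there one by one. *)
pose c := (2 * k) ^ 3.
have c0 : 0 < c by rewrite expn_gt0 muln_gt0 k0.
pose t0 := 2 * c * (2 * k).
pose rho0 := (k * k + 2 * k) * (k * k * t0) + k + 2.
pose s0 := 2 * (k * (rho0 + 2 * (4 * k) ^ k * rho0)) + k + k * rho0.
pose K1 := 2 * c * (k * (k * k * t0)).
pose K2 := k * s0 * ((rho0 + 2) * 2 ^ k) + 1.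
pose K3 := 4 * (k * (s0 + rho0 + 2 * (k * k + k * rho0))) + 5.
have [n0 n0P] := log_square_le (K1 + (K2 + K3)).
exists (maxn n0 2) => n; rewrite geq_max => /andP[/n0P nK n2] T H d0 cT cH0 kd0.
pose L := (trunc_log 2 n).+1; rewrite -/L in nK.
(* The codegree is lowered to the rounded-up value of [(n - 1) / k], so that it is
   known up to a constant. *)
pose d := (n + k - 2) %/ k.
have dk : n <= k * d + 1 /\ k * d <= n + k.
  have := divn_eq (n + k - 2) k; have := ltn_pmod (n + k - 2) k0.
  by rewrite -/d [d * k]mulnC; move: n2 k3 (k * d) (_ %% _); clear; lia.
have [kd kd'] := dk.
have dd : d <= d0.
  rewrite -ltnS ltn_divLR // mulSn [d0 * k]mulnC.
  by move: (k * d0) kd0 n2 k3; clear; lia.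
have cH := codeg_ge_le dd cH0.
pose t := t0 * L.
have c2 : 0 < 2 * c by rewrite muln_gt0.
have tE : t = (2 * c).-1.+1 * (2 * k * L).
  by rewrite prednK // /t /t0 -mulnA.
have nL : n ^ (2 * k) < 2 ^ (2 * k * L).
  rewrite [2 * k * L]mulnC (expnM 2 L) ltn_exp2r ?muln_gt0 //.
  exact: trunc_log_ltn.
have LL : L <= L * L by rewrite leq_pmulr.
have L0 : 0 < L by [].
have nK1 : K1 * L <= n.
  by apply: leq_trans nK; apply: leq_mul LL; rewrite leq_addr.
have nK2 : K2 * (L * L) <= n.
  by apply: leq_trans nK; apply: leq_mul => //; rewrite addnCA leq_addr.
have nK3 : K3 * L <= n.
  by apply: leq_trans nK; apply: leq_mul LL; rewrite addnA leq_addl.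
have nT0 : 0 < #|T| by rewrite cT; apply: ltnW.
have o_ne a b (ha : a < k) (hb : b < k) : a != b -> Ordinal ha != Ordinal hb by [].
have [|||Q [mQ cQ aQ]] := @absorbing_exists k T H d (Ordinal k0) (Ordinal k1)
  (Ordinal k3) (o_ne 0 1 k0 k1 isT) (o_ne 0 2 k0 k3 isT) (o_ne 1 2 k1 k3 isT) cH nT0 c t (k * k).
- rewrite cT /c -expnMn leq_exp2r //; move: kd n2; clear; nia.
- have c1 : 0 < (2 * c).-1 by rewrite -subn1 subn_gt0 (leq_trans _ (leq_mul (leqnn 2) c0)).
  by have := decay c1 nL; rewrite -tE prednK // cT.
- rewrite cT; apply: leq_trans nK1; rewrite /K1 /t.
  by rewrite -!mulnA.
have kdT : #|T| <= k * d + 1 by rewrite cT.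
have [[M [mM sQM cM]]|[B iB cB]] := large_matching_or_sparse k0 cH kdT mQ cQ.
  have [M' mM' cM'] := aQ M mM sQM; exists M' => //.
  move: cM'; rewrite -cT; case/orP=> // h.
  by apply: leq_trans cM _; apply: leq_trans h _; rewrite leq_addr.
rewrite -cT.
apply: (@sparse_large_matching_num k T H d (rho0 * L) (s0 * L) B) => //.
- by rewrite cT.
- move=> i; apply: leq_trans (cB i) _; rewrite -!addnA leq_add2l.
  have -> : (k * k + 2 * k) * (k * k * t) = (k * k + 2 * k) * (k * k * t0) * L.
    by rewrite /t !mulnA.
  rewrite /rho0; move: ((k * k + 2 * k) * (k * k * t0)) (L) L0 => X l.
  by clear; nia.
- rewrite /s0; move: (rho0) ((4 * k) ^ k) (L) L0; clear => r u l l0.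
  have : k <= k * l by rewrite leq_pmulr.
  by clear; lia.
- rewrite cT; apply: leq_trans nK2; rewrite /K2.
  move: (s0) (rho0) (2 ^ k) (L) L0; clear => s r u L L0.
  have : (r * L + 2) * u <= (r + 2) * u * L by nia.
  move: ((r + 2) * u) ((r * L + 2) * u) => x y h.
  have := leq_mul (leqnn (k * s * L)) h; have : 0 < L * L by rewrite muln_gt0 L0.
  by clear; lia.
rewrite cT; apply: leq_trans nK3; rewrite /K3.
move: (s0) (rho0) (L) L0; clear => s r L L0.
have : k * k * k <= k * k * k * L by rewrite leq_pmulr.
by clear -L0; lia.
Qed.

(** * From vectors to hypergraphs *)

Lemma partite_min_codeg_le (V : finType) k (P : 'I_k -> {set V})
    (E : {set {set V}}) (S : {set V}) :
  #|S| = k - 1 -> crossing P S -> partite_min_codeg P E <= deg E S.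
Proof.
move=> cS xS; have : (#|S| == k - 1) && crossing P S by rewrite cS eqxx.
rewrite /partite_min_codeg; have := mem_index_enum S.
elim: (index_enum _) => // S' r IH; rewrite inE big_cons => /orP[/eqP<- -> | Sr pS].
  exact: geq_minl.
by case: ifP => _; [apply: leq_trans (geq_minr _ _) _ |]; apply: IH.
Qed.

Lemma codeg_bound n k dlt : 0 < k ->
  (n = 1 %[mod k] /\ n %/ k <= dlt) \/ ceil_div n k <= dlt -> n <= k * dlt + 1.
Proof.
move=> k0 [[n1 h]|]; last first.
  by rewrite ceil_div_leq // mulnC => h; apply: leq_trans h (leq_addr _ _).
rewrite {1}(divn_eq n k) n1 leq_add ?leq_mod //.
by rewrite mulnC leq_mul2l h orbT.
Qed.

Section Transfer.
Variables (k n : nat) (V : finType) (E : {set {set V}}) (P : 'I_k -> {set V}).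
Hypotheses (unifE : uniform k E) (partE : kpartite P E) (cP : forall i, #|P i| = n).
Local Notation vec := {ffun 'I_k -> 'I_n}.
Implicit Types (f g : vec) (i j : 'I_k) (x y : 'I_n).

Definition vertex i x : V := enum_val (cast_ord (esym (cP i)) x).

Definition edge_of f : {set V} := [set vertex i (f i) | i : 'I_k].

Definition vectors : {set vec} := [set f | edge_of f \in E].

Lemma vertex_in i x : vertex i x \in P i.
Proof. exact: enum_valP. Qed.

Lemma vertex_inj i : injective (vertex i).
Proof. by move=> x y /enum_val_inj/cast_ord_inj. Qed.

Lemma vertex_onto i v : v \in P i -> exists x, v = vertex i x.
Proof.
move=> vP; exists (cast_ord (cP i) (enum_rank_in vP v)).
by rewrite /vertex cast_ordK enum_rankK_in.
Qed.

Lemma part_unique i j v : v \in P i -> v \in P j -> i = j.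
Proof.
move=> vi vj; apply/eqP/negPn/negP => ij; case: partE => -[dP _] _.
by have := disjointFr (dP i j ij) vi; rewrite vj.
Qed.

Lemma mem_edge_of f i v : v \in edge_of f -> v \in P i -> v = vertex i (f i).
Proof.
by case/imsetP => j _ -> vP; rewrite (part_unique vP (vertex_in j (f j))).
Qed.

Lemma vertex_edge f i : vertex i (f i) \in edge_of f.
Proof. exact: imset_f. Qed.

Lemma edge_of_inj : injective edge_of.
Proof.
move=> f g fg; apply/ffunP => i; apply: (@vertex_inj i).
by apply: mem_edge_of (vertex_in _ _); rewrite -fg vertex_edge.
Qed.

Lemma card_edge_of f : #|edge_of f| = k.
Proof.
rewrite card_imset ?card_ord // => i j ij.
by apply: (part_unique (vertex_in i (f i))); rewrite ij vertex_in.
Qed.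

Lemma codeg_vectors : codeg_ge vectors (partite_min_codeg P E).
Proof.
move=> f i; pose S := edge_of f :\ vertex i (f i).
have cS : #|S| = k - 1.
  have := cardsD1 (vertex i (f i)) (edge_of f).
  by rewrite vertex_edge card_edge_of -/S => ->; rewrite addKn.
have xS : crossing P S.
  apply/forallP => j; rewrite -(cards1 (vertex j (f j))); apply: subset_leq_card.
  apply/subsetP => v; rewrite !inE => /andP[/andP[_ vE] vP].
  by rewrite (mem_edge_of vE vP).
apply: leq_trans (partite_min_codeg_le E cS xS) _.
rewrite -(card_imset _ (@vertex_inj i)); apply: subset_leq_card.
apply/subsetP => v; rewrite inE => /andP[vS vE].
have SP w : w \in S -> w \notin P i.
  by rewrite !inE => /andP[wi wE]; apply: contra wi => /(mem_edge_of wE)->.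
have [x vx] : exists x, v = vertex i x.
  apply: vertex_onto; case: partE => _ /(_ _ i vE) c1.
  have /card_gt0P[w] : 0 < #|(v |: S) :&: P i| by rewrite c1.
  by rewrite !in_setI in_setU1 => /andP[/orP[/eqP->//|/SP/negPf->]].
apply/imsetP; exists x => //; rewrite inE inE.
suff -> : edge_of (upd f i x) = v |: S by [].
apply/eqP; rewrite eqEcard card_edge_of (unifE vE) leqnn andbT.
apply/subsetP => w /imsetP[j _ ->]; rewrite in_setU1 updE.
have [->|ji] := eqVneq j i; first by rewrite vx eqxx.
rewrite in_setD1 vertex_edge andbT; apply/orP; right.
apply: contra ji => /eqP e; apply/eqP/(part_unique (vertex_in j (f j))).
by rewrite e vertex_in.
Qed.

Lemma matching_of_vmatching (M : {set vec}) m :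
  0 < k -> vmatching vectors M -> m <= #|M| ->
  exists M' : {set {set V}}, matching E M' /\ #|M'| = m.
Proof.
move=> k0 mM le; pose M1 := [set f in take m (enum M)].
have sM1 : M1 \subset M.
  by apply/subsetP => f; rewrite inE => /mem_take; rewrite mem_enum.
have mM1 := sub_vmatching sM1 mM.
exists (edge_of @: M1); split; last first.
  rewrite (card_imset _ edge_of_inj) cardsE.
  by rewrite (card_uniqP _) ?take_uniq ?enum_uniq // size_takel // -cardE.
split.
  apply/subsetP => e /imsetP[f fM ->].
  by have := subsetP (vmatching_sub mM1) f fM; rewrite inE.
move=> e e' /imsetP[f fM ->] /imsetP[g gM ->] ne.
rewrite disjoint_subset; apply/subsetP => v /imsetP[i _ ->]; rewrite inE.
apply: contra ne => /mem_edge_of/(_ (vertex_in _ _))/vertex_inj fg.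
by rewrite (vmatching_inj mM1 fM gM fg).
Qed.

End Transfer.

Theorem corollary1p2 (k : nat) (hk : 3 <= k) :
  exists n0 : nat, forall n : nat, n0 <= n ->
  forall (V : finType) (E : {set {set V}}) (P : 'I_k -> {set V}),
    uniform k E -> kpartite P E -> (forall i : 'I_k, #|P i| = n) ->
    (n = 1 %[mod k] /\ n %/ k <= partite_min_codeg P E) \/
      ceil_div n k <= partite_min_codeg P E ->
    exists M : {set {set V}}, matching E M /\ #|M| = n - 1.
Proof.
have k0 : 0 < k by apply: leq_trans hk.
have [n0 n0P] := near_perfect_vmatching hk.
exists n0 => n nn V E P unifE partE cP hd.
have [M mM cM] := n0P n nn _ _ _ (card_ord n)
  (codeg_vectors unifE partE cP) (codeg_bound k0 hd).
by apply: (matching_of_vmatching partE k0 mM); rewrite leq_subLR addnC.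
Qed.
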